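(* Let $n\ge 2$ and let $a$, $A$, $\Theta$ be as in the context. If $u\in W^{1,A}(\mathbb{R}^n)$ is an $A$-harmonic function in $\mathbb{R}^n$, i.e. $$\int_{\mathbb{R}^n}\Theta(\nabla u)\cdot\nabla\varphi\,dx=0\qquad\forall\varphi\in C_c^\infty(\mathbb{R}^n),$$ then $u$ is identically zero in $\mathbb{R}^n$.
   Context: $a\in C^1((0,\infty))\cap C^0([0,\infty))$ satisfies $a(0)=0$, $a(t)>0$ for $t>0$, and there are positive constants $a_0,a_1$ with $a_0\le \frac{t a'(t)}{a(t)}\le a_1$ for all $t>0$. Set $A(t)=\int_0^t a(s)\,ds$ and $\Theta(X)=\frac{a(|X|)}{|X|}X$ for $X\in\mathbb{R}^n$, with $\Theta(0)=0$. Orlicz spaces: $L^A(\mathbb{R}^n)=\{u\in L^1(\mathbb{R}^n): \int_{\mathbb{R}^n}A(|u|)\,dx<\infty\}$ and $W^{1,A}(\mathbb{R}^n)=\{u\in L^A(\mathbb{R}^n): |\nabla u|\in L^A(\mathbb{R}^n)\}$ (weak gradient). *)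

(* Defs.v *)
From HB Require Import structures.
From mathcomp Require Import all_boot all_order all_algebra.
From mathcomp Require Import all_classical all_reals all_analysis.

Set Implicit Arguments.
Unset Strict Implicit.
Unset Printing Implicit Defensive.

Import Order.TTheory GRing.Theory Num.Theory.
Import numFieldNormedType.Exports.

Local Open Scope classical_set_scope.
Local Open Scope ring_scope.

Fact rV_display : measure_display. Proof. exact. Qed.

Section borel_rV.
Context {R : realType} {n : nat}.

Definition rV_borel : set (set 'rV[R]_n) := <<s open >>.

Let rV_borel0 : rV_borel set0.
Proof. exact: sigma_algebra0. Qed.

Let rV_borelC A : rV_borel A -> rV_borel (~` A).
Proof. exact: sigma_algebraC. Qed.

Let rV_borel_bigcup (F : (set 'rV[R]_n)^nat) :
  (forall i, rV_borel (F i)) -> rV_borel (\bigcup_i F i).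
Proof. exact: sigma_algebra_bigcup. Qed.

HB.instance Definition _ := @isMeasurable.Build rV_display
  'rV[R]_n rV_borel rV_borel0 rV_borelC rV_borel_bigcup.

End borel_rV.

Section rV_measurability.
Context {R : realType}.

Lemma open_measurable_rV n (A : set 'rV[R]_n) : open A -> measurable A.
Proof. exact: sub_sigma_algebra. Qed.

Lemma measurable_coord n (i : 'I_n) :
  measurable_fun [set: 'rV[R]_n] (fun x => x 0 i : R).
Proof.
apply: (measurability _ (measurable_realfun.RGenOpens.measurableE R)) => _ [_ [a [b ->] <-]].
rewrite setTI; apply: open_measurable_rV; apply: open_comp => //.
by move=> x _; exact: coord_continuous.
Qed.

Lemma measurable_fun_rVP d (T : measurableType d) n (f : T -> 'rV[R]_n) :
  (forall i, measurable_fun setT (fun t => f t 0 i)) -> measurable_fun setT f.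
Proof.
move=> mf; apply: (@measurability _ _ _ _ _ _ (@open 'rV[R]_n)) => //.
move=> _ [U oU <-]; rewrite setTI.
pose box (q : {ffun 'I_n -> rat * rat}) :=
  [set x : 'rV[R]_n | forall i, ratr (q i).1 < x 0 i < ratr (q i).2].
pose F q := if `[< box q `<=` U >] then f @^-1` box q else set0.
have -> : f @^-1` U = \bigcup_q F q.
  apply/seteqP; split => [t Uft|t [q _]]; last first.
    by rewrite /F; case: asboolP => // qU /qU.
  move: oU; rewrite openE => /(_ _ Uft) /nbhs_ballP[e /= e0 eU].
  have H i : exists q : rat * rat, [/\ f t 0 i - e < ratr q.1 < f t 0 i &
      f t 0 i < ratr q.2 < f t 0 i + e].
    have /rat_in_itvoo[q1] : f t 0 i - e < f t 0 i by rewrite ltrBlDr ltrDl.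
    have /rat_in_itvoo[q2] : f t 0 i < f t 0 i + e by rewrite ltrDl.
    by rewrite !in_itv /= => h2 h1; exists (q1, q2).
  have [q qP] := choice H.
  exists [ffun i => q i] => //; rewrite /F.
  case: asboolP => [_ i|].
    by rewrite ffunE; have [/andP[_ ->] /andP[-> _]] := qP i.
  case=> x xq; apply: eU; split=> // i j; rewrite ord1.
  rewrite /ball/= ltr_distlC.
  have [/andP[h1 _] /andP[_ h2]] := qP j.
  have := xq j; rewrite ffunE => /andP[h3 h4].
  by rewrite (lt_trans h1)// (lt_trans h4).
apply: countable_bigcupT_measurable; first exact: countableP.
move=> q; rewrite /F; case: asboolP => // _.
have -> : f @^-1` box q = \big[setI/setT]_(i < n)
    ((fun t => f t 0 i) @^-1` `](ratr (q i).1), (ratr (q i).2)[%classic).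
  rewrite -bigcap_seq; apply/seteqP; split=> [t H i _|t H i].
    by rewrite /= in_itv; exact: H.
  by have := H i (mem_index_enum i); rewrite /= in_itv.
apply: bigsetI_measurable => i _; rewrite -[X in measurable X]setTI.
by apply: mf.
Qed.

End rV_measurability.

Section rV_cons.
Context {R : realType} {n : nat}.

Definition rV_cons (p : R * 'rV[R]_n) : 'rV[R]_n.+1 := row_mx p.1%:M p.2.

Lemma rV_cons0 p : rV_cons p 0 ord0 = p.1.
Proof.
rewrite /rV_cons (_ : ord0 = lshift n (0 : 'I_1)); last exact/val_inj.
by apply: (etrans (@row_mxEl _ _ _ _ p.1%:M p.2 0 0)); rewrite mxE eqxx.
Qed.

Lemma rV_consS p i : rV_cons p 0 (lift ord0 i) = p.2 0 i.
Proof.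
rewrite /rV_cons (_ : lift ord0 i = rshift 1 i); last exact/val_inj.
exact: (@row_mxEr _ _ _ _ p.1%:M p.2 0 i).
Qed.

Lemma measurable_rV_cons : measurable_fun setT rV_cons.
Proof.
apply: measurable_fun_rVP => i; have [j ->|->] := unliftP ord0 i.
  rewrite (_ : (fun t => _) = (fun x : 'rV[R]_n => x 0 j) \o snd).
    exact: (measurableT_comp (measurable_coord j)).
  by apply/funext => p; rewrite rV_consS.
by rewrite (_ : (fun t => _) = fst)//; apply/funext => p; rewrite rV_cons0.
Qed.

Lemma rV_cons_surj (x : 'rV[R]_n.+1) :
  rV_cons (x 0 ord0, \row_i x 0 (lift ord0 i)) = x.
Proof.
by apply/rowP => i; have [j ->|->] := unliftP ord0 i;
  rewrite ?rV_cons0 ?rV_consS ?mxE.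
Qed.

Lemma rV_consK p : (rV_cons p 0 ord0, \row_i rV_cons p 0 (lift ord0 i)) = p.
Proof.
case: p => x y; rewrite rV_cons0; congr pair.
by apply/rowP => i; rewrite mxE rV_consS.
Qed.

End rV_cons.

(* The library's instance is shadowed by the one for subprobabilities. *)
Lemma product_sigma_finite d1 d2 (T1 : measurableType d1)
    (T2 : measurableType d2) (R : realType)
    (m1 : {sigma_finite_measure set T1 -> \bar R})
    (m2 : {sigma_finite_measure set T2 -> \bar R}) :
  sigma_finite setT (m1 \x m2)%E.
Proof.
have /sigma_finiteP[F [TF ndF Foo]] := sigma_finiteT m1.
have /sigma_finiteP[G [TG ndG Goo]] := sigma_finiteT m2.
exists (fun n => F n `*` G n).
  rewrite -setXTT TF TG predeqE => -[x y]; split.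
    move=> [/= [n _ Fnx] [k _ Gky]]; exists (maxn n k) => //; split.
    - by move: x Fnx; exact/subsetPset/ndF/leq_maxl.
    - by move: y Gky; exact/subsetPset/ndG/leq_maxr.
  by move=> [n _ []/= ? ?]; split; exists n.
move=> k; have [? ?] := Foo k; have [? ?] := Goo k.
split; first exact: measurableX.
by rewrite product_measure1E// lte_mul_pinfty// ge0_fin_numE.
Qed.

Section rV_product.
Local Open Scope ereal_scope.
Context {R : realType} {n : nat}.
Variable m : {sigma_finite_measure set 'rV[R]_n -> \bar R}.

Definition rV_product : set 'rV[R]_n.+1 -> \bar R :=
  pushforward (@lebesgue_measure R \x m) rV_cons.

Let rV_product0 : rV_product set0 = 0.
Proof. by rewrite /rV_product /pushforward preimage_set0 measure0. Qed.

Let rV_product_ge0 A : 0 <= rV_product A.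
Proof. exact: (@measure_ge0 _ _ _ (@lebesgue_measure R \x m)). Qed.

Let rV_product_sigma_additive : semi_sigma_additive rV_product.
Proof.
exact: (@measure_semi_sigma_additive _ _ _
  (measure_function_pushforward__canonical__measure_function_Measure
     (lebesgue_measure \x m) measurable_rV_cons)).
Qed.

HB.instance Definition _ := isMeasure.Build _ _ _ rV_product
  rV_product0 rV_product_ge0 rV_product_sigma_additive.

Let rV_product_sigma_finite : sigma_finite setT rV_product.
Proof.
have [F TF Foo] := product_sigma_finite (@lebesgue_measure R) m.
pose g (x : 'rV[R]_n.+1) : R * 'rV[R]_n := (x 0%R ord0, \row_i x 0%R (lift ord0 i))%R.
have mg : measurable_fun setT g.
  apply: measurable_fun_pair; first exact: measurable_coord.
  apply: measurable_fun_rVP => i.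
  rewrite (_ : (fun t => _) = fun x : 'rV[R]_n.+1 => x 0%R (lift ord0 i)).
    exact: measurable_coord.
  by apply/funext => x; rewrite mxE.
exists (fun k => g @^-1` F k).
  by rewrite -preimage_bigcup -TF preimage_setT.
move=> k; have [mF Foo'] := Foo k; split.
  by rewrite -[X in measurable X]setTI; exact: mg.
rewrite /rV_product /pushforward -comp_preimage.
rewrite (_ : g \o rV_cons = idfun); first by rewrite preimage_id.
by apply/funext => p; exact: rV_consK.
Qed.

HB.instance Definition _ := Measure_isSigmaFinite.Build _ _ _ rV_product
  rV_product_sigma_finite.

End rV_product.

Fixpoint lebesgue_rV (R : realType) (n : nat) :
    {sigma_finite_measure set 'rV[R]_n -> \bar R} :=
  match n with
  | 0 => dirac (0 : 'rV[R]_0)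
  | n'.+1 => rV_product (lebesgue_rV R n')
  end.

Lemma measurable_rV_box (R : realType) n (A : 'I_n -> set R) :
  (forall i, measurable (A i)) ->
  measurable [set x : 'rV[R]_n | forall i, A i (x 0 i)].
Proof.
move=> mA; rewrite (_ : [set x | _] = \big[setI/setT]_(i < n)
    ((fun x : 'rV[R]_n => x 0 i) @^-1` A i)); last first.
  rewrite -bigcap_seq; apply/seteqP; split=> [t H i _|t H i]; first exact: H.
  exact: (H i (mem_index_enum i)).
apply: bigsetI_measurable => i _; rewrite -[X in measurable X]setTI.
exact: measurable_coord.
Qed.

Lemma lebesgue_rV_box (R : realType) n (A : 'I_n -> set R) :
  (forall i, measurable (A i)) ->
  lebesgue_rV R n [set x | forall i, A i (x 0 i)] =
  (\prod_(i < n) lebesgue_measure (A i))%E.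
Proof.
elim: n A => [|n IHn] A mA.
  rewrite big_ord0 (_ : [set x | _] = setT); first exact: diracT.
  by apply/funext => x; apply/propext; split=> // _ i; have := ltn_ord i.
pose B := [set x : 'rV[R]_n | forall i, A (lift ord0 i) (x 0 i)].
have mB : measurable B := measurable_rV_box (fun i => mA (lift ord0 i)).
rewrite big_ord_recl -IHn//= -/B.
have <- := @product_measure1E _ _ _ _ _ (@lebesgue_measure R)
  (lebesgue_rV R n) _ _ (mA ord0) mB.
rewrite /rV_product /pushforward; congr (_ _); apply/seteqP; split=> p /=.
  by move=> H; split => [|i]; [have := H ord0|have := H (lift ord0 i)];
    rewrite (rV_cons0, rV_consS).
move=> [H0 HS] i; have [j ->|->] := unliftP ord0 i.
  by rewrite rV_consS; exact: HS.
by rewrite rV_cons0.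
Qed.

Section euclidean.
Context {R : realType} {n : nat}.
Implicit Types x y : 'rV[R]_n.

Definition dotp x y : R := \sum_i x 0 i * y 0 i.

(* The library norm `|x| on 'rV[R]_n is the sup norm. *)
Definition enorm x : R := Num.sqrt (dotp x x).

End euclidean.

Section test_functions.
Context {R : realType} {n : nat}.
Implicit Types f : 'rV[R]_n -> R.

Definition partial (i : 'I_n) f : 'rV[R]_n -> R :=
  fun x => 'D_(delta_mx 0 i) f x.

Definition grad f (x : 'rV[R]_n) : 'rV[R]_n := \row_i partial i f x.

Definition smooth f := forall s : seq 'I_n,
  continuous (foldr partial f s) /\
  forall i x, derivable (foldr partial f s) x (delta_mx 0 i).

Definition test_function f :=
  smooth f /\ compact (closure [set x | f x != 0]).

End test_functions.

Section sobolev.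
Context {R : realType} {n : nat}.
Implicit Types (u : 'rV[R]_n -> R) (G : 'rV[R]_n -> 'rV[R]_n).

Local Notation mu := (lebesgue_rV R n).

Definition locally_integrable_rV u :=
  measurable_fun setT u /\
  forall K : set 'rV[R]_n, compact K -> (\int[mu]_(x in K) `|u x|%:E < +oo)%E.

Definition is_weak_gradient u G :=
  [/\ locally_integrable_rV u,
      forall i, locally_integrable_rV (fun x => G x 0 i) &
      forall phi, test_function phi -> forall i,
        (\int[mu]_x (u x * partial i phi x)%:E =
         - \int[mu]_x (G x 0 i * phi x)%:E)%E].

(* Weak gradients are unique almost everywhere; some representative is chosen,
   and the value is junk when u is not weakly differentiable. *)
Definition weak_grad u : 'rV[R]_n -> 'rV[R]_n :=
  xget (cst 0) (is_weak_gradient u).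

Definition orlicz (A : R -> R) : set ('rV[R]_n -> R) :=
  [set u | mu.-integrable setT (EFin \o u) /\
           (\int[mu]_x (A `|u x|)%:E < +oo)%E].

Definition orlicz_sobolev (A : R -> R) : set ('rV[R]_n -> R) :=
  [set u | [/\ orlicz A u,
               exists G, is_weak_gradient u G &
               orlicz A (enorm \o weak_grad u)]].

End sobolev.

Section A_harmonic.
Context {R : realType}.
Variable a : R -> R.

Definition young_fun (t : R) : R := \int[lebesgue_measure]_(s in `[0, t]) a s.

(* Theta a 0 = 0, because the scaled vector is 0. *)
Definition Theta n (X : 'rV[R]_n) : 'rV[R]_n := (a (enorm X) / enorm X) *: X.

Definition A_harmonic n (u : 'rV[R]_n -> R) :=
  forall phi, test_function phi ->
    (\int[lebesgue_rV R n]_x (dotp (Theta (weak_grad u x)) (grad phi x))%:E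
     = 0)%E.

End A_harmonic.

(* Main.v *)
(* Write G for the weak gradient of u. Testing the equation with translates of an
   even product mollifier rho_e, multiplying by u(y) and integrating gives, by
   Fubini and the definition of G, the identity
     int Theta(G(x)) . (G * rho_e)(x) dx = 0,
   so that no regularity of u * rho_e is ever needed. Since a is increasing,
   |Theta_i(X) Y_i| <= a(|X|)|X| + a(|Y|)|Y|, and a(t)t <= (1 + a1) A(t) makes
   a(|G|)|G| integrable; hence z |-> int Theta(G(x)) . G(x + z) dx is
   continuous at 0 by the L1 continuity of translations, and letting e -> 0
   yields int a(|G|)|G| = 0. So G = 0 almost everywhere; then u * rho_e is
   constant along a coordinate direction and tends to 0 at infinity, whence
   u * rho_e = 0 for all e, and the same limit argument with the sign of u in
   place of Theta(G) gives u = 0. *)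

Require Import Defs.
From mathcomp Require Import all_boot all_order all_algebra.
From mathcomp Require Import all_classical all_reals all_analysis.
From mathcomp Require Import measurable_realfun lra.

Set Implicit Arguments.
Unset Strict Implicit.
Unset Printing Implicit Defensive.

Import Order.TTheory GRing.Theory Num.Theory.
Import numFieldNormedType.Exports.

Local Open Scope classical_set_scope.
Local Open Scope ring_scope.

(** * Smooth bump functions *)

Section smooth_line.
Context {R : realType}.
Implicit Types f g : R -> R.

(** [Theta(G)] need not be integrable: what is available is a bound by a constant plus an integrable
    function. Two exchanges of integrals therefore rest on different bounds. Against a derivative of
    the mollifier, which is bounded and integrable, this bound suffices and is uniform in the centre
    y, so the weight u(y) only has to be integrable. Against translates of G the pointwise bound on
    products takes over, in the role of Young's inequality for the conjugate of A. The two growth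
    constants act separately: the lower one makes [a] monotone, the upper one compares [a t * t]
    with A. The mollifiers are not normalised, and e -> 0 is not taken as an actual limit: a pairing
    continuous and nonzero at 0 keeps its sign on a small cube, so its integral against a kernel
    positive on that cube and zero outside cannot vanish. *)

Definition smooth1 f := forall k x, derivable (derive1n k f) x 1.

(** The flat functions x^(-m) exp(-1/x), extended by 0. The index is there because differentiation
    leads from m to m + 1 and m + 2. *)
Definition exp_inv (m : nat) (x : R) : R :=
  if 0 < x then x^-1 ^+ m * expR (- x^-1) else 0.

Lemma exp_inv_ge0 m x : 0 <= exp_inv m x.
Proof.
rewrite /exp_inv; case: ifPn => // x0.
by rewrite mulr_ge0 ?expR_ge0// exprn_ge0// invr_ge0 ltW.
Qed.

(** A single term of the exponential series at 1/x, that of degree m + 1, already beats x^(-m) by a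
    factor x. *)
Lemma exp_inv_le m x : 0 < x -> exp_inv m x <= (m.+1)`!%:R * x.
Proof.
move=> x0; rewrite /exp_inv x0 expRN.
have y0 : 0 < x^-1 by rewrite invr_gt0.
rewrite ler_pdivrMr ?expR_gt0//.
have F0 : 0 < (m.+1)`!%:R :> R by rewrite ltr0n fact_gt0.
have : x^-1 ^+ m.+1 / (m.+1)`!%:R <= expR x^-1.
  by apply: le_trans (expR_ge1Dxn m (ltW y0)); rewrite lerDr.
rewrite ler_pdivrMr// => h.
have -> : x^-1 ^+ m = x * x^-1 ^+ m.+1.
  by rewrite exprS mulrA mulfV ?mul1r// gt_eqF.
by rewrite (mulrC _ x) -mulrA ler_pM2l// mulrC.
Qed.

Lemma is_derive_exp_inv m (x : R) :
  is_derive x (1 : R) (exp_inv m)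
    (- m%:R * exp_inv m.+1 x + exp_inv m.+2 x).
Proof.
have [x0|x0|->] := ltgtP x 0.
- apply: (@near_eq_is_derive _ _ _ (cst 0)) => //.
    near=> y; rewrite /exp_inv ifN// -leNgt ltW//.
    by near: y; exact: lt_nbhsl.
  rewrite /exp_inv ifN -?leNgt ?(ltW x0)// ?ifN -?leNgt ?(ltW x0)// mulr0 addr0.
  exact: is_derive_cst.
- apply: (@near_eq_is_derive _ _ _ ((fun y => y^-1) ^+ m * (fun y => expR (- y^-1)))).
    near=> y; rewrite /exp_inv ifT; first by rewrite fctE exprfctE.
    by near: y; exact: lt_nbhsr.
  have xn : x != 0 by rewrite gt_eqF.
  have dV : is_derive x (1 : R) (fun y : R => y^-1) (- x ^- 2 *: 1).
    exact: is_deriveV.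
  rewrite /exp_inv x0.
  have dE : is_derive x (1 : R) (fun y : R => expR (- y^-1)) (expR (- x^-1) * x ^- 2).
    have := @is_derive1_comp _ (@expR R) (fun y : R => - y^-1) x.
    move=> /(_ _ _ (is_derive_expR _)) h.
    by apply: h; apply: is_derive_eq; rewrite scaler1 opprK.
  have dX := @is_deriveX _ _ (fun y : R => y^-1) m x 1 _ dV.
  apply: is_derive_eq (is_deriveM dX dE) _; rewrite exprfctE.
  rewrite /GRing.scale/= mulr1 -exprVn.
  move: (x^-1) => y; move: (expR _) => e.
  rewrite addrC; congr (_ + _); last by rewrite (mulrC e) mulrA -exprD addn2.
  rewrite mulrN mulNr mulrC mulNr; congr (- _).
  case: m {dX} => [|m]; first by rewrite !mul0r.
  rewrite [_.-1]/= -2!mulrA; congr (_ * _); by rewrite mulrA -exprD addn2.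
- have e0 k : exp_inv k 0 = 0 by rewrite /exp_inv ltxx.
  rewrite !e0 mulr0 addr0.
  have cv : h^-1 *: (exp_inv m (h + 0) - exp_inv m 0) @[h --> 0^'] --> (0 : R).
    apply/cvgrPdist_le => e e_gt0; near=> h.
    rewrite e0 sub0r normrN subr0 addr0 /GRing.scale/=.
    have [h0|h0] := ltP 0 h; last first.
      by rewrite /exp_inv ltNge h0 mulr0 normr0 ltW.
    (* Dividing by h raises the index by one, so the linear bound for index m + 1 sends the
       difference quotient to 0. *)
    have -> : h^-1 * exp_inv m h = exp_inv m.+1 h.
      by rewrite /exp_inv h0 mulrA -exprS.
    rewrite ger0_norm ?exp_inv_ge0//. apply: le_trans (exp_inv_le _ h0) _.
    rewrite mulrC -ler_pdivlMr ?ltr0n ?fact_gt0//.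
    rewrite -[leLHS]ger0_norm ?(ltW h0)//.
    near: h; apply: dnbhs0_le.
    by rewrite divr_gt0// ltr0n fact_gt0.
  have cv' : h^-1 *: ((exp_inv m \o shift 0) (h *: (1 : R)) - exp_inv m 0)
      @[h --> 0^'] --> (0 : R).
    by under eq_fun do rewrite /= /GRing.scale/= mulr1.
  apply: DeriveDef; first by apply/cvg_ex; exists 0.
  exact/cvg_lim.
Unshelve. all: by end_near.
Qed.

(* A class of functions closed under differentiation consists of smooth functions. *)
Inductive bump_algebra : (R -> R) -> Prop :=
| bump_exp_inv m : bump_algebra (exp_inv m)
| bump_cst c : bump_algebra (cst c)
| bump_add f g : bump_algebra f -> bump_algebra g -> bump_algebra (f + g)
| bump_mul f g : bump_algebra f -> bump_algebra g -> bump_algebra (f * g)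
| bump_affine (c s : R) f :
    bump_algebra f -> bump_algebra (fun t => f (c + s * t)).

Lemma bump_algebra_derive f : bump_algebra f ->
  (forall x, derivable f x 1) /\ bump_algebra f^`()%classic.
Proof.
suff H : bump_algebra f ->
    exists2 f', (forall x, is_derive x (1 : R) f (f' x)) & bump_algebra f'.
  move=> /H[f' df bf']; split; first by move=> x; have [] := df x.
  suff -> : f^`()%classic = f' by [].
  by apply/funext => x; rewrite derive1E; have [] := df x.
elim=> {f}.
- move=> m; exists (cst (- m%:R) * exp_inv m.+1 + exp_inv m.+2).
    by move=> x; exact: is_derive_exp_inv.
  by apply: bump_add (bump_exp_inv _); apply: bump_mul (bump_exp_inv _);
     exact: bump_cst.
- by move=> c; exists (cst 0) => [x|]; [exact: is_derive_cst|exact: bump_cst].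
- move=> f g _ [f' df bf'] _ [g' dg bg']; exists (f' + g'); last exact: bump_add.
  by move=> x; exact: is_deriveD.
- move=> f g bf [f' df bf'] bg [g' dg bg']; exists (f * g' + g * f').
    by move=> x; exact: is_deriveM.
  by apply: bump_add; exact: bump_mul.
- move=> c s f _ [f' df bf'].
  exists (cst s * fun t => f' (c + s * t)); last first.
    by apply: bump_mul; [exact: bump_cst|exact: bump_affine].
  move=> x; rewrite fctE /= mulrC; apply: is_derive1_comp.
  apply: is_derive_eq (is_deriveD (is_derive_cst c x (1 : R))
    (is_deriveZ s (is_derive_id x (1 : R)))) _.
  by rewrite add0r scaler1.
Qed.

Lemma bump_algebra_smooth1 f : bump_algebra f -> smooth1 f.
Proof.
move=> bf k; move: f bf; elim: k => [f /bump_algebra_derive[]//|k ih f].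
by move=> /bump_algebra_derive[_ /ih]; rewrite derive1Sn.
Qed.


End smooth_line.

(** * Tensor products of functions of one variable *)

Section product_functions.
Context {R : realType} {n : nat}.
Implicit Types (f : 'I_n -> R -> R) (x : 'rV[R]_n).

Definition prodf f x : R := \prod_i f i (x 0 i).

(** Along the i-th direction all factors but one are frozen, so the difference quotient is a
    one-variable quotient times the constant [c]. *)
Lemma is_derive_prodf f x i :
  (forall t, derivable (f i) t 1) ->
  is_derive x (delta_mx 0 i : 'rV[R]_n) (prodf f)
    (prodf (fun j => if j == i then (f j)^`()%classic else f j) x).
Proof.
move=> df.
pose c := \prod_(j | j != i) f j (x 0 j).
have splitE g (y : 'rV[R]_n) : (forall j, j != i -> y 0 j = x 0 j) ->
    (forall j, j != i -> g j = f j) -> prodf g y = g i (y 0 i) * c.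
  move=> yx gf; rewrite /prodf (bigD1 i)//=; congr (_ * _).
  by apply: eq_bigr => j ji; rewrite yx// gf.
rewrite splitE//=; last by move=> j /negPf ->.
rewrite eqxx.
have E : (fun h => h^-1 *: ((prodf f \o shift x) (h *: (delta_mx 0 i : 'rV[R]_n)) - prodf f x))
    = (fun h => h^-1 *: ((f i \o shift (x 0 i)) (h *: (1:R)) - f i (x 0 i))) * cst c.
  apply/funext => h; rewrite fctE/= !splitE// => [|j ji].
    by rewrite !mxE !eqxx/= -mulrBl /GRing.scale/= mulrA.
  by rewrite !mxE (negPf ji) andbF mulr0 add0r.
have cv : h^-1 *: ((prodf f \o shift x) (h *: (delta_mx 0 i : 'rV[R]_n)) - prodf f x)
    @[h --> 0^'] --> (f i)^`()%classic (x 0 i) * c.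
  rewrite E derive1E; apply: cvgM; last exact: cvg_cst.
  exact: df.
apply: DeriveDef; first by apply/cvg_ex; eexists; exact: cv.
exact/cvg_lim.
Qed.

Lemma partial_prodf f i : (forall j t, derivable (f j) t 1) ->
  partial i (prodf f) = prodf (fun j => if j == i then (f j)^`()%classic else f j).
Proof.
move=> df; apply/funext => x; rewrite /partial.
by have [_ ->] := is_derive_prodf x (df i).
Qed.

Lemma continuous_prodf f : (forall j, continuous (f j)) -> continuous (prodf f).
Proof.
move=> cf; apply: continuous_big => [z|i _ x]; first exact: mul_continuous.
by apply: continuous_comp; [exact: coord_continuous|exact: cf].
Qed.

Lemma smooth_prodf f : (forall j, smooth1 (f j)) -> smooth (prodf f).
Proof.
move=> sf s.
(* An iterated partial derivative depends only on how often each direction occurs, and it is again a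
   tensor product. *)
have E : foldr partial (prodf f) s =
    prodf (fun j => derive1n (count_mem j s) (f j)).
  elim: s => [|i s ih]; first by congr prodf; apply/funext.
  rewrite /= ih partial_prodf//; last by move=> j t; exact: sf.
  congr prodf; apply/funext => j.
  by rewrite eq_sym; case: eqP => //= _; rewrite add0n.
rewrite E; split.
  apply: continuous_prodf => j t; apply: differentiable_continuous.
  by apply/derivable1_diffP; exact: sf.
move=> i x; have [] // := @is_derive_prodf (fun j => derive1n (count_mem j s) (f j)) x i.
by move=> t; exact: sf.
Qed.

Lemma test_function_prodf f (M : R) : (0 < n)%N -> (forall j, smooth1 (f j)) ->
  (forall j t, M < `|t| -> f j t = 0) -> test_function (prodf f).
Proof.
move=> n0 sf sup; split; first exact: smooth_prodf.
pose K := [set x : 'rV[R]_n | forall i, `[- M, M]%classic (x 0 i)].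
have cK : compact K.
  apply: (@rV_compact R n (fun=> `[- M, M]%classic)) => i.
  exact: segment_compact.
apply: (subclosed_compact _ cK); first exact: closed_closure.
have clK : closed K by apply: compact_closed cK; exact: norm_hausdorff.
rewrite [X in _ `<=` X](closure_id _).1//; apply: closureS.
move=> x /= fx i; rewrite /= in_itv/= -ler_norml leNgt; apply: contra fx => Mx.
by rewrite /prodf (bigD1 i)//= sup// mul0r.
Qed.

End product_functions.

(** * Translation invariance *)

Section translation_invariance.
Local Open Scope ereal_scope.
Context {R : realType}.

Lemma lebesgue_measure_translate (c : R) (A : set R) : measurable A ->
  lebesgue_measure ((fun x => x + c)%R @^-1` A) = lebesgue_measure A.
Proof.
move=> mA.
have mf : measurable_fun [set: measurableTypeR R]
    ((fun x => x + c)%R : measurableTypeR R -> measurableTypeR R).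
  exact: measurable_funD.
apply/esym.
apply: (@lebesgue_measure_unique R
  (measure_function_pushforward__canonical__measure_function_Measure
    (@lebesgue_measure R) mf)) => // _ [[a b]] _ <-.
rewrite /= /pushforward.
rewrite (_ : _ @^-1` _ = `](a - c)%R, (b - c)%R]%classic); last first.
  by apply/seteqP; split => x /=; rewrite !in_itv/= ltrBlDr lerBrDr.
by rewrite !lebesgue_measure_itv/= !lte_fin ltrD2r -!EFinB opprB addrA subrK.
Qed.

Lemma measurable_addr n (z : 'rV[R]_n) :
  measurable_fun setT (fun x : 'rV[R]_n => x + z)%R.
Proof.
apply: measurable_fun_rVP => i.
under eq_fun do rewrite mxE.
by apply: measurable_funD => //; exact: measurable_coord.
Qed.

Lemma rV_cons_add n (p : R * 'rV[R]_n) (z : 'rV[R]_n.+1) :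
  (rV_cons p + z = rV_cons (p.1 + z ord0 ord0, p.2 + \row_i z ord0 (lift ord0 i)))%R.
Proof.
apply/rowP => i; rewrite mxE; have [j ->|->] := unliftP ord0 i.
  by rewrite !rV_consS !mxE.
by rewrite !rV_cons0.
Qed.

(** Induction on the dimension: a translation of rows splits into one of the head and one of the
    tail, and a measure that agrees with the product measure on rectangles equals it. *)
Lemma lebesgue_rV_translate n (z : 'rV[R]_n) (A : set 'rV[R]_n) :
  measurable A ->
  lebesgue_rV R n ((fun x => x + z)%R @^-1` A) = lebesgue_rV R n A.
Proof.
elim: n z A => [|n ih] z A mA.
  congr (_ _); apply/seteqP; split => x /=; by rewrite !thinmx0.
rewrite /= /rV_product /pushforward.
set B := rV_cons @^-1` A.
have mB : measurable B.
  by rewrite -[X in measurable X]setTI; exact: measurable_rV_cons.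
pose T (p : measurableTypeR R * 'rV[R]_n) : measurableTypeR R * 'rV[R]_n :=
  (p.1 + z ord0 ord0, p.2 + \row_i z ord0 (lift ord0 i))%R.
have mT : measurable_fun setT T.
  apply: measurable_fun_pair.
    by apply: measurable_funD.
  apply: (measurableT_comp (measurable_addr _)); exact: measurable_snd.
rewrite (_ : rV_cons @^-1` _ = T @^-1` B); last first.
  by apply/seteqP; split => p /=; rewrite rV_cons_add.
apply/esym.
have U := @product_measure_unique _ _ _ _ _ (@lebesgue_measure R) (lebesgue_rV R n)
  (measure_function_pushforward__canonical__measure_function_Measure
    (@lebesgue_measure R \x lebesgue_rV R n)%E mT).
apply: U => //= C D mC mD.
rewrite /pushforward.
rewrite (_ : T @^-1` _ = ((fun x => x + z ord0 ord0)%R @^-1` C) `*`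
  ((fun x => x + \row_i z ord0 (lift ord0 i))%R @^-1` D))//.
have m1 : measurable ((fun x : R => x + z ord0 ord0)%R @^-1` C).
  have mc : measurable_fun setT (fun x : R => x + z ord0 ord0)%R.
    exact: measurable_funD.
  by rewrite -[X in measurable X]setTI; exact: mc.
rewrite [LHS]product_measure1E//.
  by rewrite ih//; congr (_ * _); exact: lebesgue_measure_translate.
by rewrite -[X in measurable X]setTI; apply: measurable_addr.
Qed.

Lemma integral_rV_translate n (z : 'rV[R]_n) (f : 'rV[R]_n -> \bar R) :
  measurable_fun setT f ->  (forall x, 0 <= f x) ->
  \int[lebesgue_rV R n]_x f (x + z)%R = \int[lebesgue_rV R n]_x f x.
Proof.
move=> mf f0; have mz := measurable_addr z.
transitivity (\int[pushforward (lebesgue_rV R n) (fun x => x + z)%R]_x f x).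
  by rewrite ge0_integral_pushforward.
by apply: eq_measure_integral => A mA _; exact: lebesgue_rV_translate.
Qed.

Lemma integrable_rV_translate n (z : 'rV[R]_n) (f : 'rV[R]_n -> \bar R) :
  (lebesgue_rV R n).-integrable setT f ->
  (lebesgue_rV R n).-integrable setT (fun x => f (x + z)%R).
Proof.
move=> /integrableP[mf If]; apply/integrableP; split.
  by apply: measurableT_comp => //; exact: measurable_addr.
rewrite (integral_rV_translate z (f := fun x => `|f x|))//.
exact: measurableT_comp.
Qed.

End translation_invariance.

(** * Integrable real-valued functions *)

Section real_integrable.
Context d (T : measurableType d) (R : realType).
Variable mu : {measure set T -> \bar R}.
Implicit Types f g : T -> R.

Local Notation L1 f := (mu.-integrable setT (EFin \o f)).

Lemma L1_measurable f : L1 f -> measurable_fun setT f.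
Proof. by move=> /integrableP[/measurable_EFinP]. Qed.

Lemma L1_le f g : measurable_fun setT f -> L1 g ->
  (forall x, `|f x| <= g x) -> L1 f.
Proof.
move=> mf ig fg; apply: (le_integrable measurableT _ _ ig).
  exact/measurable_EFinP.
move=> x _ /=; rewrite lee_fin (le_trans (fg x))// ler_norm//.
Qed.

Lemma L1_add f g : L1 f -> L1 g -> L1 (fun x => f x + g x).
Proof. by move=> lf lg; exact: (integrableD measurableT lf lg). Qed.

Lemma L1_scale c f : L1 f -> L1 (fun x => c * f x).
Proof. by move=> lf; exact: (integrableZl measurableT c lf). Qed.

Lemma L1_sub f g : L1 f -> L1 g -> L1 (fun x => f x - g x).
Proof.
move=> lf /(L1_scale (-1)) lg; have := L1_add lf lg.
by under eq_fun do rewrite mulN1r.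
Qed.

Lemma L1_norm f : L1 f -> L1 (fun x => `|f x|).
Proof. by move=> lf; exact: (integrable_norm lf). Qed.

Lemma L1_cst0 : L1 (fun=> 0).
Proof. exact: integrable0. Qed.

Lemma L1_sum I (s : seq I) (F : I -> T -> R) : (forall i, L1 (F i)) ->
  L1 (fun x => \sum_(i <- s) F i x).
Proof.
move=> lF; elim: s => [|i s ih].
  by under eq_fun do rewrite big_nil; exact: L1_cst0.
by under eq_fun do rewrite big_cons; exact: L1_add.
Qed.

Lemma Rintegral_sum I (s : seq I) (F : I -> T -> R) : (forall i, L1 (F i)) ->
  \int[mu]_x (\sum_(i <- s) F i x) = \sum_(i <- s) \int[mu]_x F i x.
Proof.
move=> lF; elim: s => [|i s ih].
  rewrite big_nil; under eq_Rintegral do rewrite big_nil.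
  by rewrite /Rintegral integral0.
rewrite big_cons -ih -RintegralD//; last exact: L1_sum.
by apply: eq_Rintegral => x _; rewrite big_cons.
Qed.

Lemma L1_indic (A : set T) : measurable A -> (mu A < +oo)%E -> L1 \1_A.
Proof.
move=> mA fA; apply/integrableP; split.
  exact/measurable_EFinP/measurable_indic.
under eq_integral do rewrite /= ger0_norm ?indicE//.
by rewrite integral_indic// setIT.
Qed.

Lemma Rdominated_cvg (f_ : nat -> T -> R) f g :
  (forall k, measurable_fun setT (f_ k)) -> measurable_fun setT f -> L1 g ->
  (forall x, f_ k x @[k --> \oo] --> f x) ->
  (forall k x, `|f_ k x| <= g x) ->
  \int[mu]_x f_ k x @[k --> \oo] --> \int[mu]_x f x.
Proof.
move=> mf_ mf lg cv dom; apply: fine_cvg.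
have lf : L1 f.
  apply: (L1_le mf lg) => x.
  have /cvg_norm cx := cv x; rewrite -(cvg_lim _ cx)//.
  apply: limr_le; first by apply/cvg_ex; exists `|f x|.
  by apply: nearW => k; exact: dom.
rewrite fineK; last exact: integrable_fin_num.
have [|||||_ _ h] := @dominated_convergence _ _ _ mu _ measurableT
  (fun k => EFin \o f_ k) (EFin \o f) (EFin \o g); last exact: h.
- by move=> k; exact/measurable_EFinP.
- exact/measurable_EFinP.
- by apply: aeW => x _; apply: cvg_EFin => //; [exact: nearW|exact: cv].
- by [].
- by apply: aeW => x k _; rewrite lee_fin; exact: dom.
Qed.

End real_integrable.

(** * Continuity of translations in L1 *)

Section translation_continuity.
Context {R : realType} {n : nat}.
Implicit Types f g : 'rV[R]_n -> R.

Local Notation mu := (lebesgue_rV R n).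
Local Notation L1 f := (mu.-integrable setT (EFin \o f)).

Lemma L1_translate (z : 'rV[R]_n) f : L1 f -> L1 (fun x => f (x + z)).
Proof. by move=> lf; exact: (integrable_rV_translate z lf). Qed.

Lemma Rintegral_translate (z : 'rV[R]_n) f :
  measurable_fun setT f -> (forall x, 0 <= f x) ->
  \int[mu]_x f (x + z) = \int[mu]_x f x.
Proof.
move=> mf f0; rewrite /Rintegral; congr fine.
apply: (integral_rV_translate z (f := EFin \o f)); last by move=> x; rewrite lee_fin.
exact/measurable_EFinP.
Qed.

Variable z : nat -> 'rV[R]_n.
Hypothesis z0 : z k @[k --> \oo] --> (0 : 'rV[R]_n).

(** Stated along the fixed sequence [z], to match dominated convergence, which concerns
    sequences. *)
Definition translation_cvg f :=
  \int[mu]_x `|f (x + z k) - f x| @[k --> \oo] --> (0 : R).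

(** Translation is an isometry of L1, so the approximation error enters twice, once translated and
    once not; with the error for [g m] this makes three thirds of e. *)
Lemma translation_cvg_approx f (g : nat -> 'rV[R]_n -> R) :
  L1 f -> (forall m, L1 (g m)) -> (forall m, translation_cvg (g m)) ->
  \int[mu]_x `|f x - g m x| @[m --> \oo] --> (0 : R) -> translation_cvg f.
Proof.
move=> lf lg tg fg; apply/cvgrPdist_le => e e0.
have e3 : 0 < e / 3 by rewrite divr_gt0.
have /cvgrPdist_le/(_ _ e3)[m _ /(_ _ (leqnn m))] := fg.
rewrite /= sub0r normrN ger0_norm; last exact: Rintegral_ge0.
move=> fgm.
have /cvgrPdist_le/(_ _ e3) := tg m.
apply: filterS => k; rewrite sub0r normrN ger0_norm; last exact: Rintegral_ge0.
move=> gk; rewrite sub0r normrN ger0_norm; last exact: Rintegral_ge0.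
have ltf := L1_translate (z k) lf; have ltg := L1_translate (z k) (lg m).
have ld := L1_norm (L1_sub lf (lg m)).
have ldt := L1_translate (z k) ld.
have lgg := L1_norm (L1_sub ltg (lg m)).
apply: (@le_trans _ _ (\int[mu]_x (`|f (x + z k) - g m (x + z k)|
     + (`|g m (x + z k) - g m x| + `|f x - g m x|)))).
  apply: le_Rintegral => //.
  - exact: L1_norm (L1_sub ltf lf).
  - by apply: L1_add => //; exact: L1_add.
  - move=> x _; rewrite (distrC (f x)).
    have -> : f (x + z k) - f x = (f (x + z k) - g m (x + z k)) +
      ((g m (x + z k) - g m x) + (g m x - f x)) by lra.
    apply: le_trans (ler_normD _ _) _; rewrite lerD2l.
    exact: ler_normD.
rewrite RintegralD//; last exact: L1_add.
rewrite RintegralD//.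
rewrite (@Rintegral_translate (z k) (fun x => `|f x - g m x|))//; last first.
  exact: L1_measurable ld.
by lra.
Qed.

Lemma translation_cvg_sub f g : L1 f -> L1 g ->
  translation_cvg f -> translation_cvg g -> translation_cvg (fun x => f x - g x).
Proof.
move=> lf lg tf tg.
have := cvgD tf tg; rewrite addr0 => tfg.
rewrite /translation_cvg.
apply: (@squeeze_cvgr _ _ _ _ (cst 0) _ _ _ _ _ (tfg _)); last exact: cvg_cst.
apply: nearW => k; rewrite Rintegral_ge0//=.
have ltf := L1_norm (L1_sub (L1_translate (z k) lf) lf).
have ltg := L1_norm (L1_sub (L1_translate (z k) lg) lg).
rewrite fctE -RintegralD//; apply: le_Rintegral => //.
- have lfg := L1_sub lf lg.
  exact: L1_norm (L1_sub (L1_translate (z k) lfg) lfg).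
- exact: L1_add.
- move=> x _.
  have -> : f (x + z k) - g (x + z k) - (f x - g x) =
     (f (x + z k) - f x) - (g (x + z k) - g x) by lra.
  exact: ler_normB.
Qed.

Lemma translation_cvg_scale c f : L1 f ->
  translation_cvg f -> translation_cvg (fun x => c * f x).
Proof.
move=> lf tf; rewrite /translation_cvg.
rewrite (_ : (fun k => _) =
    cst `|c| \* (fun k => \int[mu]_x `|f (x + z k) - f x|)); last first.
  apply/funext => k /=; rewrite -RintegralZl//.
    by apply: eq_Rintegral => x _; rewrite -mulrBr normrM.
  by apply: L1_norm (L1_sub _ lf); exact: L1_translate.
by rewrite -(mulr0 `|c|); apply: cvgM tf; exact: cvg_cst.
Qed.

Lemma translation_cvg0 : translation_cvg (fun=> 0).
Proof.
rewrite /translation_cvg; under eq_fun do under eq_Rintegral do rewrite subrr normr0.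
by rewrite /Rintegral integral0; exact: cvg_cst.
Qed.

Lemma translation_cvg_sum I (s : seq I) (F : I -> 'rV[R]_n -> R) :
  (forall i, L1 (F i)) -> (forall i, translation_cvg (F i)) ->
  translation_cvg (fun x => \sum_(i <- s) F i x).
Proof.
move=> lF tF; elim: s => [|i s ih].
  by under eq_fun do rewrite big_nil; exact: translation_cvg0.
have lS : L1 (fun x => \sum_(j <- s) F j x) by exact: L1_sum.
have := translation_cvg_sub (lF i) (L1_scale (-1) lS) (tF i)
   (translation_cvg_scale (-1) lS ih).
rewrite (_ : (fun x => _) = (fun x => \sum_(j <- i :: s) F j x))//.
by apply/funext => x; rewrite big_cons mulN1r opprK.
Qed.

(* The integral of |1_U(x + z) - 1_U(x)| is 2 (mu U - int 1_U(x) 1_U(x + z)), and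
   for open U the last integrand tends pointwise to 1_U as z tends to 0: no
   hypothesis on the boundary of U is needed. *)
Lemma translation_cvg_open (U : set 'rV[R]_n) :
  open U -> (mu U < +oo)%E -> translation_cvg \1_U.
Proof.
move=> oU fU; have mU := open_measurable_rV oU.
have lU : L1 \1_U := L1_indic mU fU.
have mP k : measurable_fun setT (fun x : 'rV[R]_n => \1_U x * \1_U (x + z k) : R).
  apply: measurable_funM; first exact: measurable_indic.
  exact: (L1_measurable (L1_translate (z k) lU)).
have bP k x : `|\1_U x * \1_U (x + z k) : R| <= \1_U x.
  rewrite !indicE; case: (x \in U); case: (_ \in U);
    by rewrite ?mul1r ?mul0r ?normr0 ?normr1.
have lP k : L1 (fun x : 'rV[R]_n => \1_U x * \1_U (x + z k)).
  exact: L1_le (mP k) lU (bP k).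
have cP : \int[mu]_x (\1_U x * \1_U (x + z k)) @[k --> \oo] -->
    (\int[mu]_x \1_U x : R).
  apply: (Rdominated_cvg (g := \1_U)) => //.
  move=> x; have [xU|xU] := pselect (U x); last first.
    rewrite [X in _ --> X]indicE memNset//=.
    under eq_fun do rewrite indicE memNset//= mul0r.
    exact: cvg_cst.
  rewrite [X in _ --> X]indicE mem_set//=.
  under eq_fun do rewrite indicE mem_set//= mul1r.
  apply: cvg_near_cst.
  have xz : x + z k @[k --> \oo] --> x.
    by rewrite -[X in _ --> X]addr0; apply: cvgD => //; exact: cvg_cst.
  have Uz : \forall k \near \oo, U (x + z k).
    exact: (xz U (open_nbhs_nbhs (conj oU xU))).
  by near=> k; rewrite indicE mem_set//; near: k.
rewrite /translation_cvg.
have -> : (fun k => \int[mu]_x `|\1_U (x + z k) - \1_U x|) =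
    (fun k => 2 * ((\int[mu]_x \1_U x : R) - \int[mu]_x (\1_U x * \1_U (x + z k)))).
  apply/funext => k.
  have -> : \int[mu]_x `|\1_U (x + z k) - \1_U x| =
     \int[mu]_x ((\1_U (x + z k) + \1_U x) - (2 * (\1_U x * \1_U (x + z k))) : R).
    apply: eq_Rintegral => x _; rewrite !indicE.
    by case: (x \in U); case: (_ \in U);
       rewrite /= ?subrr ?subr0 ?sub0r ?normrN ?normr1 ?normr0; lra.
  rewrite RintegralB//; last 2 first.
  - by apply: L1_add => //; exact: L1_translate.
  - exact: L1_scale.
  rewrite RintegralZl// RintegralD//; last exact: L1_translate.
  rewrite (@Rintegral_translate (z k) \1_U)//.
  by lra.
rewrite -[X in _ --> X](mulr0 2) -(subrr (\int[mu]_x \1_U x : R)).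
apply: cvgM; first exact: cvg_cst.
by apply: cvgB => //; exact: cvg_cst.
Unshelve. all: by end_near. Qed.

End translation_continuity.

Section translation_continuity_L1.
Context {R : realType} {n : nat}.

Local Notation mu := (lebesgue_rV R n).
Local Notation L1 f := (mu.-integrable setT (EFin \o f)).

(** The ball is taken in the sup norm, so it is a box whose measure is explicit. *)
Definition cube (r : R) : set 'rV[R]_n := ball (0 : 'rV[R]_n) r.

Lemma cubeE r : 0 < r ->
  cube r = [set x | forall i, `]-r, r[%classic (x 0 i)].
Proof.
move=> r0; apply/seteqP; split => x /= bx.
  move=> i; have [_ /(_ 0 i)] := bx; rewrite mxE /ball/= sub0r normrN.
  by rewrite in_itv/= -ltr_norml.
split=> // i j; rewrite ord1 mxE /ball/= sub0r normrN.
by have := bx j; rewrite /= in_itv/= -ltr_norml.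
Qed.

Lemma open_cube r : open (cube r).
Proof. exact: ball_open. Qed.

Lemma lebesgue_rV_cube r : 0 < r -> mu (cube r) = ((r *+ 2) ^+ n)%:E.
Proof.
move=> r0; rewrite cubeE// (@lebesgue_rV_box R n (fun=> `]-r, r[%classic))//.
under eq_bigr do rewrite lebesgue_measure_itv/= lte_fin gtrN// -EFinB opprK -mulr2n.
by rewrite prodEFin prodr_const card_ord.
Qed.

Lemma cvg_indic_cube (x : 'rV[R]_n) : \1_(cube M.+1%:R) x @[M --> \oo] --> (1 : R).
Proof.
apply: cvg_near_cst.
exists (Num.truncn `|x|) => // M /= xM.
rewrite indicE mem_set// /cube -ball_normE /= sub0r normrN.
by apply: lt_le_trans (truncnS_gt _) _; rewrite ler_nat.
Qed.

Variable z : nat -> 'rV[R]_n.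
Hypothesis z0 : z k @[k --> \oo] --> (0 : 'rV[R]_n).

Lemma L1_indicI (B S : set 'rV[R]_n) : measurable B -> (mu B < +oo)%E ->
  measurable S -> L1 (\1_(S `&` B) : _ -> R).
Proof.
move=> mB fB mS; apply: L1_indic; first exact: measurableI.
by apply: le_lt_trans fB; apply: le_measure; rewrite ?inE//; exact: measurableI.
Qed.

(** Dynkin's argument with the open sets as generating pi-system. Intersecting with B of finite
    measure keeps all indicators integrable and turns a complement into the difference of [\1_B] and
    [\1_(S]&[B)]. *)
Lemma translation_cvg_indicI (B S : set 'rV[R]_n) :
  open B -> (mu B < +oo)%E -> measurable S ->
  translation_cvg z (\1_(S `&` B) : _ -> R).
Proof.
move=> oB fB mS; have mB := open_measurable_rV oB.
apply: (@dynkin_induction _ 'rV[R]_n open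
  (fun S => translation_cvg z (\1_(S `&` B) : _ -> R))) => //.
- by move=> U V; exact: openI.
- by rewrite setTI; exact: translation_cvg_open.
- move=> U oU; apply: translation_cvg_open => //; first exact: openI.
  have mU := open_measurable_rV oU.
  by apply: le_lt_trans fB; apply: le_measure; rewrite ?inE//; exact: measurableI.
- move=> {mS}S mS tS.
  rewrite (_ : \1_(~` S `&` B) = fun x => \1_B x - \1_(S `&` B) x :> R).
    apply: translation_cvg_sub => //.
    + exact: L1_indic.
    + exact: L1_indicI.
    + exact: translation_cvg_open.
  apply/funext => x; rewrite !indicE !in_setI in_setC.
  by case: (x \in S); case: (x \in B); rewrite /= ?subrr ?subr0.
- move=> F mF tF PF.
  pose s N (x : 'rV[R]_n) : R := \sum_(k <- iota 0 N) \1_(F k `&` B) x.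
  have lFB k : L1 (\1_(F k `&` B) : _ -> R) by exact: L1_indicI.
  have mU : measurable (\bigcup_k F k) by exact: bigcup_measurable.
  have lU : L1 (\1_(\bigcup_k F k `&` B) : _ -> R) by exact: L1_indicI.
  have ls N : L1 (s N) by exact: L1_sum.
  (* By disjointness the partial sums are indicators of partial unions; this gives both their
     pointwise limit and their domination by the indicator of the whole union. *)
  have sE N x : s N x = \1_(\big[setU/set0]_(k < N) F k `&` B) x.
    elim: N => [|N ih].
      by rewrite /s big_nil big_ord0 set0I indicE in_set0.
    rewrite /s -addn1 iotaD big_cat/= -/(s N x) ih big_seq1 add0n addn1.
    rewrite big_ord_recr/= !indicE !in_setI in_setU.
    have [xN|] := boolP (x \in F N); last by rewrite orbF addr0.
    have -> : (x \in \big[setU/set0]_(k < N) F k) = false.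
      apply/negP; rewrite inE -bigcup_mkord => -[k /= kN xk].
      have := trivIsetP.1 tF k N I I; rewrite ltn_eqF// => /(_ isT).
      by move=> /seteqP[/(_ x) + _]; apply; split => //; exact/set_mem.
    by rewrite /= add0r.
  apply: (@translation_cvg_approx _ _ z _ s) => //.
  + by move=> N; apply: translation_cvg_sum.
  + rewrite -[X in _ --> X](_ : \int[mu]_x (0 : R) = 0); last first.
    by rewrite /Rintegral integral0.
    apply: (Rdominated_cvg (g := \1_(\bigcup_k F k `&` B))) => //.
    * by move=> N; exact: L1_measurable (L1_norm (L1_sub lU (ls N))).
    * move=> x; apply: cvg_near_cst.
      have [[[k _ xk] xB]|xF] := pselect ((\bigcup_k F k `&` B) x).
        exists k.+1 => // N /= kN; rewrite sE !indicE mem_set; last by split => //; exists k.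
        rewrite mem_set ?subrr ?normr0//; split => //.
        by rewrite -bigcup_mkord; exists k.
      apply: nearW => N; rewrite sE !indicE memNset// memNset ?subrr ?normr0//.
      move=> [+ xB]; rewrite -bigcup_mkord => -[k _ xk].
      by apply: xF; split => //; exists k.
    * move=> N x; rewrite normr_id sE !indicE !in_setI.
      have [xB|_] := boolP (x \in B); last by rewrite !andbF subrr normr0.
      rewrite !andbT.
      have [xN|xN] := boolP (x \in \big[setU/set0]_(k < N) F k).
        rewrite (_ : x \in _); first by rewrite subrr normr0.
        rewrite inE; move: xN; rewrite inE -bigcup_mkord => -[k _ xk].
        by exists k.
      by rewrite subr0 ger0_norm.
Qed.

Import HBSimple.

(** Two approximations in a row: by simple functions, then by their truncations to cubes, since a
    level set (for instance that of the value 0) may have infinite measure. *)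
Theorem L1_translation_cvg (f : 'rV[R]_n -> R) : L1 f -> translation_cvg z f.
Proof.
move=> lf.
have [g [lg _ gf]] := approximation_sfun_integrable measurableT lf.
have {}gf : \int[mu]_x `|f x - g m x| @[m --> \oo] --> (0 : R).
  by apply: (fine_cvg gf).
apply: (@translation_cvg_approx _ _ z f (fun m => g m)) => // m.
(* The successor keeps the radius positive, as the formula for the measure of a cube requires. *)
pose c M := cube M.+1%:R.
have mc M : measurable (c M) by apply: open_measurable_rV; exact: open_cube.
have fc M : (mu (c M) < +oo)%E by rewrite lebesgue_rV_cube// ltry.
have lgc M : L1 (fun x => g m x * \1_(c M) x).
  apply: L1_le (L1_norm (lg m)) _.
    by apply: measurable_funM => //; exact: measurable_indic.
  move=> x; rewrite normrM indicE; case: (_ \in _).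
    by rewrite normr1 mulr1.
  by rewrite normr0 mulr0.
apply: (@translation_cvg_approx _ _ z (g m) (fun M x => g m x * \1_(c M) x)) => //.
- move=> M.
  pose s := finmap.enum_fset (fset_set (range (g m))).
  rewrite (_ : (fun x => _) = fun x =>
    \sum_(i < size s) (s`_i * \1_((g m @^-1` [set s`_i]) `&` c M) x)).
    apply: translation_cvg_sum => i.
      by apply: L1_scale; exact: L1_indicI.
    apply: translation_cvg_scale; first exact: L1_indicI.
    by apply: translation_cvg_indicI => //; exact: open_cube.
  apply/funext => x; rewrite fimfunEord mulr_suml; apply: eq_bigr => i _.
  by rewrite indicI -mulrA.
- rewrite -[X in _ --> X](_ : \int[mu]_x (0 : R) = 0); last first.
    by rewrite /Rintegral integral0.
  apply: (Rdominated_cvg (g := fun x => `|g m x|)) => //.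
  + by move=> M; exact: L1_measurable (L1_norm (L1_sub (lg m) (lgc M))).
  + exact: L1_norm.
  + move=> x; rewrite -(normr0 R) -(subrr (g m x)) -[X in _ - X]mulr1.
    apply: cvg_norm; apply: cvgB; first exact: cvg_cst.
    by apply: cvgM; [exact: cvg_cst|exact: cvg_indic_cube].
  + move=> M x; rewrite normr_id indicE; case: (_ \in _).
      by rewrite mulr1 subrr normr0.
    by rewrite mulr0 subr0.
Qed.

End translation_continuity_L1.

(** * Mollifiers *)

Section bump.
Context {R : realType}.

(** A product of two one-sided flat functions: even in t, and positive exactly for |t| < e when e >
    0. *)
Definition bump (e t : R) : R := exp_inv 0 (e + t) * exp_inv 0 (e - t).

Lemma bumpE e : bump e =
  (fun t => exp_inv 0 (e + 1 * t)) * (fun t => exp_inv 0 (e + (-1) * t)).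
Proof. by apply/funext => t; rewrite fctE mul1r mulN1r. Qed.

Lemma bump_in_algebra e : bump_algebra (bump e).
Proof.
by rewrite bumpE; apply: bump_mul; apply: bump_affine; exact: bump_exp_inv.
Qed.

Lemma smooth1_bump_comp e c s : smooth1 (fun t : R => bump e (c + s * t)).
Proof.
apply: bump_algebra_smooth1.
exact: (bump_affine c s (bump_in_algebra e)).
Qed.

Lemma derivable_bump e t : derivable (bump e) t 1.
Proof. by have [+ _] := bump_algebra_derive (bump_in_algebra e); exact. Qed.

Lemma continuous_bump e : continuous (bump e).
Proof.
move=> t; apply: differentiable_continuous; apply/derivable1_diffP.
exact: derivable_bump.
Qed.

Lemma continuous_derive_bump e : continuous (bump e)^`()%classic.
Proof.
move=> t; apply: differentiable_continuous; apply/derivable1_diffP.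
have [_ /bump_algebra_derive[+ _]] := bump_algebra_derive (bump_in_algebra e).
exact.
Qed.

Lemma bumpN e t : bump e (- t) = bump e t.
Proof. by rewrite /bump opprK mulrC. Qed.

Lemma bump_ge0 e t : 0 <= bump e t.
Proof. by rewrite mulr_ge0// exp_inv_ge0. Qed.

Lemma bump_gt0 e t : `|t| < e -> 0 < bump e t.
Proof.
rewrite ltr_norml => /andP[t1 t2].
have h1 : 0 < e + t by lra.
have h2 : 0 < e - t by lra.
by rewrite /bump /exp_inv h1 h2 !expr0 !mul1r mulr_gt0// expR_gt0.
Qed.

Lemma bump_eq0 e t : e <= `|t| -> bump e t = 0.
Proof.
rewrite ler_normr => /orP[h|h].
  by rewrite /bump mulrC /exp_inv ifN ?mul0r// -leNgt; lra.
by rewrite /bump /exp_inv ifN ?mul0r// -leNgt; lra.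
Qed.

Lemma derive_bump_eq0 e t : e < `|t| -> (bump e)^`()%classic t = 0.
Proof.
move=> et; rewrite derive1E (@near_eq_derive _ _ _ _ (cst 0)) ?derive_cst//.
near=> y; apply: bump_eq0; apply: ltW.
near: y; apply: (cvgr_gt `|t|) et.
exact: (cvg_norm cvg_id).
Unshelve. all: by end_near. Qed.

End bump.

Section compact_support.
Context {R : realType} {n : nat}.
Implicit Types f : 'rV[R]_n -> R.

Local Notation mu := (lebesgue_rV R n).
Local Notation L1 f := (mu.-integrable setT (EFin \o f)).

Lemma continuous_measurable_rV f : continuous f -> measurable_fun setT f.
Proof.
move=> cf.
apply: (measurability _ (measurable_realfun.RGenOpens.measurableE R)) => _ [_ [a [b ->] <-]].
by rewrite setTI; apply: open_measurable_rV; apply: open_comp => // x _; exact: cf.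
Qed.

Lemma compact_support_bounded f r : continuous f ->
  (forall (x : 'rV[R]_n) i, r < `|x 0 i| -> f x = 0) -> exists C, forall x, `|f x| <= C.
Proof.
move=> cf f0.
(* The absolute value of r keeps the box nonempty whatever the sign of r, so that a maximum exists
   on it. *)
pose A := [set x : 'rV[R]_n | forall i, `[- `|r|, `|r|]%classic (x 0 i)].
have cA : compact A.
  apply: (@rV_compact R n (fun=> `[- `|r|, `|r|]%classic)) => i.
  exact: segment_compact.
have A0 : A !=set0 by exists 0 => i; rewrite /= mxE in_itv/= oppr_le0 normr_ge0.
have cnf : {within A, continuous (fun x => `|f x|)}.
  apply: continuous_subspaceT => x.
  by apply: (@continuous_comp _ _ _ f Num.norm); [exact: cf|exact: norm_continuous].
have [c _ fc] := @EVT_max_rV R n _ _ A0 cA cnf.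
exists `|f c| => x; have [Ax|Ax] := pselect (A x); first by apply: fc; rewrite inE.
rewrite (_ : f x = 0) ?normr0//.
have /existsNP[i /negP] : ~ forall i, x 0 i \in `[- `|r|, `|r|] by [].
rewrite in_itv/= -ler_norml -ltNge => h.
by apply: (f0 x i); apply: le_lt_trans h; exact: ler_norm.
Qed.

Lemma compact_support_L1 f r : 0 < r -> continuous f ->
  (forall (x : 'rV[R]_n) i, r < `|x 0 i| -> f x = 0) -> L1 f.
Proof.
move=> r0 cf f0; have [C fC] := compact_support_bounded cf f0.
(* The support lies in the closed cube of radius r; the larger radius puts it inside an open one. *)
pose B : set 'rV[R]_n := cube (r + 1).
have r1 : 0 < r + 1 by lra.
have lB : L1 (\1_B : _ -> R).
  have fB : (mu B < +oo)%E by rewrite /B lebesgue_rV_cube// ltry.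
  by apply: L1_indic fB; apply: open_measurable_rV; exact: open_cube.
apply: L1_le (L1_scale C lB) _; first exact: continuous_measurable_rV.
move=> x; rewrite indicE.
have [xB|xB] := boolP (x \in B); first by rewrite mulr1.
rewrite mulr0 (_ : f x = 0) ?normr0//.
move: xB; rewrite notin_setE /B cubeE//= => /existsNP[i /negP].
rewrite in_itv/= -ltr_norml -leNgt => h.
by apply: (f0 x i); lra.
Qed.

End compact_support.

Section mollifier.
Context {R : realType} {n : nat}.

Local Notation mu := (lebesgue_rV R n).
Local Notation L1 f := (mu.-integrable setT (EFin \o f)).

Definition mollifier (e : R) : 'rV[R]_n -> R := prodf (fun=> bump e).

(** The i-th partial derivative of [mollifier e], in closed form. *)
Definition dmollifier (e : R) (i : 'I_n) : 'rV[R]_n -> R :=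
  prodf (fun j => if j == i then (bump e)^`()%classic else bump e).

Lemma mollifierN e (x : 'rV[R]_n) : mollifier e (- x) = mollifier e x.
Proof. by apply: eq_bigr => i _; rewrite mxE bumpN. Qed.

Lemma mollifier_ge0 e x : 0 <= mollifier e x.
Proof. by apply: prodr_ge0 => i _; exact: bump_ge0. Qed.

Lemma mollifier_gt0 e x : 0 < e -> cube e x -> 0 < mollifier e x.
Proof.
move=> e0; rewrite cubeE// => xe; apply: prodr_gt0 => i _; apply: bump_gt0.
by have := xe i; rewrite /= in_itv/= -ltr_norml.
Qed.

Lemma mollifier_eq0 e (x : 'rV[R]_n) i : e <= `|x 0 i| -> mollifier e x = 0.
Proof. by move=> h; rewrite /mollifier /prodf (bigD1 i)//= bump_eq0// mul0r. Qed.

Lemma mollifier_notin_cube e x : 0 < e -> ~ cube e x -> mollifier e x = 0.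
Proof.
move=> e0; rewrite cubeE//= => /existsNP[i /negP].
by rewrite in_itv/= -ltr_norml -leNgt; exact: mollifier_eq0.
Qed.

Lemma dmollifier_eq0 e i (x : 'rV[R]_n) j : e < `|x 0 j| -> dmollifier e i x = 0.
Proof.
move=> h; rewrite /dmollifier /prodf (bigD1 j)//=.
by case: ifP => _; rewrite ?derive_bump_eq0 ?bump_eq0 ?mul0r// ltW.
Qed.

Lemma continuous_mollifier e : continuous (mollifier e).
Proof. by apply: continuous_prodf => i; exact: continuous_bump. Qed.

Lemma continuous_dmollifier e i : continuous (dmollifier e i).
Proof.
apply: continuous_prodf => j; case: ifP => _; last exact: continuous_bump.
exact: continuous_derive_bump.
Qed.

Lemma L1_mollifier e : 0 < e -> L1 (mollifier e).
Proof.
move=> e0; apply: (compact_support_L1 e0); first exact: continuous_mollifier.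
by move=> x i /ltW; exact: mollifier_eq0.
Qed.

Lemma L1_dmollifier e i : 0 < e -> L1 (dmollifier e i).
Proof.
move=> e0; apply: (compact_support_L1 e0); first exact: continuous_dmollifier.
by move=> x j; exact: dmollifier_eq0.
Qed.

Lemma mollifier_bounded e : exists C, forall x, `|mollifier e x| <= C.
Proof.
apply: (compact_support_bounded (r := e)); first exact: continuous_mollifier.
by move=> x i /ltW; exact: mollifier_eq0.
Qed.

Lemma dmollifier_bounded e i : exists C, forall x, `|dmollifier e i x| <= C.
Proof.
apply: (compact_support_bounded (r := e)); first exact: continuous_dmollifier.
by move=> x j; exact: dmollifier_eq0.
Qed.

Lemma prodf_affine (f : 'I_n -> R -> R) (x y : 'rV[R]_n) (s : R) :
  prodf f (y + s *: x) = prodf (fun j t => f j (y 0 j + s * t)) x.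
Proof. by apply: eq_bigr => j _; rewrite !mxE. Qed.

(** Both signs of s occur later: rho(x - y) serves as a test function of x in the equation (s = 1)
    and as a test function of y in the definition of the weak gradient (s = -1). *)
Lemma test_function_mollifier e (y : 'rV[R]_n) s : (0 < n)%N -> 0 < e -> `|s| = 1 ->
  test_function (fun x => mollifier e (y + s *: x)).
Proof.
move=> n0 e0 s1; rewrite (_ : (fun x => _) =
    prodf (fun j t => bump e (y 0 j + s * t))); last first.
  by apply/funext => x; exact: prodf_affine.
(* The sum of all |y_k| gives one radius valid for every coordinate. *)
apply: (@test_function_prodf _ _ _ (e + \sum_k `|y 0 k|)) => // [j|j t yt].
  exact: smooth1_bump_comp.
apply: bump_eq0.
have yj : `|y 0 j| <= \sum_k `|y 0 k|.
  by rewrite (bigD1 j)//= lerDl sumr_ge0.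
have := ler_normB (y 0 j + s * t) (y 0 j); rewrite addrAC subrr add0r normrM s1 mul1r.
lra.
Qed.

Lemma partial_mollifier e (y : 'rV[R]_n) s i : partial i (fun x => mollifier e (y + s *: x)) =
  (fun x => s * dmollifier e i (y + s *: x)).
Proof.
rewrite (_ : (fun x => _) =
    prodf (fun j t => bump e (y 0 j + s * t))); last first.
  by apply/funext => x; exact: prodf_affine.
rewrite partial_prodf; last first.
  move=> j t; exact: (@smooth1_bump_comp R e (y 0 j) s 0%N t).
apply/funext => x.
have d t : (fun t => bump e (y 0 i + s * t))^`()%classic t =
    s * (bump e)^`()%classic (y 0 i + s * t).
  rewrite derive1E.
  have gd : is_derive t 1 (fun t : R => y 0 i + s * t) s.
    apply: is_derive_eq (is_deriveD (is_derive_cst (y 0 i) t (1 : R))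
      (is_deriveZ s (is_derive_id t (1 : R)))) _.
    by rewrite add0r scaler1.
  have [_ ->] := @is_derive1_comp _ (bump e) (fun t => y 0 i + s * t) _ _ _
    (derivableP (@derivable_bump R e (y 0 i + s * t))) gd.
  by rewrite mulrC derive1E.
rewrite /dmollifier prodf_affine /prodf (bigD1 i)//= eqxx d.
rewrite [in RHS](bigD1 i)//= eqxx mulrA; congr (_ * _).
by apply: eq_bigr => j /negPf ->.
Qed.

End mollifier.

(** * Mollified pairings *)

Section real_fubini.
Context d1 d2 (T1 : measurableType d1) (T2 : measurableType d2) (R : realType).
Variable m1 : {sigma_finite_measure set T1 -> \bar R}.
Variable m2 : {sigma_finite_measure set T2 -> \bar R}.
Variables (K : T1 -> T2 -> R) (b : T2 -> R).
Hypothesis mK : measurable_fun setT (fun p : T1 * T2 => K p.1 p.2).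
Hypothesis lK1 : forall x, m2.-integrable setT (EFin \o K x).
Hypothesis lK2 : forall y, m1.-integrable setT (EFin \o K^~ y).
Hypothesis lb : m2.-integrable setT (EFin \o b).
Hypothesis Kb : forall y, \int[m1]_x `|K x y| <= b y.

Let f (p : T1 * T2) := (K p.1 p.2)%:E.

Let mf : measurable_fun setT f.
Proof. exact/measurable_EFinP. Qed.

(** By Tonelli, the integrable majorant [b] of the inner integrals makes K integrable on the
    product. *)
Let intf : (m1 \x m2)%E.-integrable setT f.
Proof.
apply/(integrable21ltyP _ _ mf).
have /integrableP[_] := lb; apply: le_lt_trans.
apply: ge0_le_integral => //.
- by move=> y _; exact: integral_ge0.
- apply: (measurable_fun_fubini_tonelli_G (abse \o f)) => //=.
  exact: measurableT_comp.
- by apply: measurableT_comp => //; exact: measurable_int lb.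
- move=> y _; rewrite /f /=.
  have /integrable_norm/(integrable_fin_num measurableT) := lK2 y.
  move=> /fineK <-; rewrite lee_fin.
  by apply: le_trans (ler_norm _); exact: Kb.
Qed.

Lemma L1_Rintegral : m2.-integrable setT (EFin \o (fun y => \int[m1]_x K x y)).
Proof.
apply: (L1_le _ lb).
  apply/measurable_EFinP.
  rewrite (_ : EFin \o _ = fubini_G m1 f); first exact: (measurable_fubini_G intf).
  apply/funext => y; rewrite /= fineK//.
  exact: (integrable_fin_num measurableT (lK2 y)).
move=> y; apply: le_trans (Kb y).
exact: (le_normr_Rintegral measurableT (lK2 y)).
Qed.

Lemma Rintegral_fubini :
  \int[m1]_x (\int[m2]_y K x y) = \int[m2]_y (\int[m1]_x K x y).
Proof.
rewrite /Rintegral; congr fine.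
under eq_integral do rewrite fineK ?(integrable_fin_num measurableT (lK1 _))//.
under [RHS]eq_integral do rewrite fineK ?(integrable_fin_num measurableT (lK2 _))//.
exact: (Fubini intf).
Qed.

End real_fubini.

Section mollification.
Context {R : realType} {n : nat}.

Local Notation mu := (lebesgue_rV R n).
Local Notation L1 f := (mu.-integrable setT (EFin \o f)).
Implicit Types (F g P : 'rV[R]_n -> R).

Lemma Rintegral_translate_L1 (z : 'rV[R]_n) f : L1 f ->
  \int[mu]_x f (x + z) = \int[mu]_x f x.
Proof.
move=> lf; have mz := measurable_addr z; rewrite /Rintegral; congr fine.
transitivity (\int[pushforward mu (fun x : 'rV[R]_n => x + z)%R]_x (f x)%:E)%E.
  rewrite (integral_pushforward mz)//; first exact: measurable_int lf.
  exact: integrable_rV_translate lf.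
by apply: eq_measure_integral => A mA _; exact: lebesgue_rV_translate.
Qed.

Section dominated_pairing.
Variables F g P : 'rV[R]_n -> R.
Hypotheses (mF : measurable_fun setT F) (lg : L1 g) (lP : L1 P).
Hypothesis FgP : forall x y, `|F x * g y| <= P x + P y.

Let P_ge0 x : 0 <= P x.
Proof. by have := le_trans (normr_ge0 _) (FgP x x); rewrite -mulr2n pmulrn_lge0. Qed.

(** [FgP] at the points x and x + z bounds the integrand by P plus a translate of P; F itself may be
    unbounded and not integrable. *)
Lemma L1_pairing z : L1 (fun x => F x * g (x + z)).
Proof.
apply: (L1_le _ (L1_add lP (L1_translate z lP))) => //.
by apply: measurable_funM => //; exact: L1_measurable (L1_translate z lg).
Qed.

Lemma le_Rintegral_pairing z :
  \int[mu]_x `|F x * g (x + z)| <= 2 * \int[mu]_x P x.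
Proof.
have lPz := L1_translate z lP.
apply: (@le_trans _ _ (\int[mu]_x (P x + P (x + z)))).
  by apply: le_Rintegral => //; [exact: L1_norm (L1_pairing z)|exact: L1_add].
by rewrite RintegralD// Rintegral_translate_L1// mulr_natl mulr2n.
Qed.

Lemma cvg_pairing (z : nat -> 'rV[R]_n) : z k @[k --> \oo] --> (0 : 'rV[R]_n) ->
  \int[mu]_x (F x * g (x + z k)) @[k --> \oo] --> \int[mu]_x (F x * g x).
Proof.
move=> z0.
have lFg : L1 (fun x => F x * g x).
  by have := L1_pairing 0; under eq_fun do rewrite addr0.
(* Where |F| <= M the translations of g converge in L1; where |F| > M the
   difference is at most 4 P(x) + (P(x + z) - P(x)). *)
pose C (M : nat) : set 'rV[R]_n := [set x | M%:R < `|F x|].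
have mC M : measurable (C M).
  rewrite -[X in measurable X]setTI.
  rewrite (_ : C M = (fun x => `|F x|) @^-1` `]M%:R, +oo[); last first.
    by apply/seteqP; split => x /=; rewrite in_itv/= andbT.
  by apply: (measurableT_comp (@normr_measurable _ _) mF).
have lCP M : L1 (fun x => \1_(C M) x * P x).
  apply: (L1_le _ lP).
    by apply: measurable_funM; [exact: measurable_indic|exact: L1_measurable lP].
  move=> x; rewrite normrM (ger0_norm (P_ge0 x)) indicE.
  by case: (_ \in _); rewrite ?normr1 ?mul1r// normr0 mul0r.
have CP0 : \int[mu]_x (\1_(C M) x * P x) @[M --> \oo] --> (0 : R).
  rewrite -[X in _ --> X](_ : \int[mu]_x (0 : R) = 0); last first.
    by rewrite /Rintegral integral0.
  apply: (Rdominated_cvg (g := P)) => //.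
  - by move=> M; exact: L1_measurable (lCP M).
  - move=> x; apply: cvg_near_cst.
    exists (Num.truncn `|F x|).+1 => // M /= FM.
    rewrite indicE memNset ?mul0r//= => h.
    by have := lt_trans h (truncnS_gt `|F x|); rewrite ltr_nat ltnNge FM.
  - move=> M x; rewrite normrM (ger0_norm (P_ge0 x)) indicE.
    by case: (_ \in _); rewrite ?normr1 ?mul1r// normr0 mul0r.
apply/cvgrPdist_le => e e0.
(* The bound 4 P on [C M] will cost 4 (e / 8) = e / 2, and each of the two translation errors e /
   4. *)
have [M CM] : exists M, \int[mu]_x (\1_(C M) x * P x) <= e / 8.
  have e8 : 0 < e / 8 by rewrite divr_gt0.
  have /cvgrPdist_le/(_ _ e8)[M _ /(_ _ (leqnn M))] := CP0.
  rewrite /= sub0r normrN => h; exists M; apply: le_trans h; exact: ler_norm.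
(* M + 1 instead of M, because M may be 0. *)
have eM : 0 < e / (4 * (M%:R + 1)) by rewrite divr_gt0// mulr_gt0// ltr_wpDl.
have e4 : 0 < e / 4 by rewrite divr_gt0.
have /cvgrPdist_le/(_ _ eM) := L1_translation_cvg z0 lg.
have /cvgrPdist_le/(_ _ e4) := L1_translation_cvg z0 lP.
apply: filterS2 => k.
rewrite !sub0r !normrN.
rewrite ger0_norm; last exact: Rintegral_ge0.
rewrite ger0_norm; last exact: Rintegral_ge0.
move=> Pk gk.
rewrite distrC -RintegralB//; last exact: L1_pairing.
have lgz := L1_norm (L1_sub (L1_translate (z k) lg) lg).
have lPz := L1_norm (L1_sub (L1_translate (z k) lP) lP).
have lD := L1_sub (L1_pairing (z k)) lFg.
apply: (le_trans (le_normr_Rintegral measurableT lD)).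
apply: (@le_trans _ _ (\int[mu]_x (M%:R * `|g (x + z k) - g x| +
    (`|P (x + z k) - P x| + 4 * (\1_(C M) x * P x))))).
  apply: le_Rintegral => //.
  - exact: L1_norm.
  - apply: L1_add; first exact: L1_scale.
    by apply: L1_add => //; exact: L1_scale.
  - move=> x _; have [FM|FM] := leP `|F x| M%:R.
      rewrite -mulrBr normrM.
      apply: (@le_trans _ _ (M%:R * `|g (x + z k) - g x|)).
        exact: ler_wpM2r.
      rewrite lerDl addr_ge0// mulr_ge0// mulr_ge0// indicE//.
    rewrite [\1_(C M) x]indicE mem_set//= mul1r.
    apply: (@le_trans _ _ (`|P (x + z k) - P x| + 4 * P x)); last first.
      by rewrite lerDr mulr_ge0.
    apply: le_trans (ler_normB _ _) _.
    have h1 := FgP x (x + z k); have h2 := FgP x x.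
    have h3 := ler_norm (P (x + z k) - P x).
    lra.
have lCP4 := L1_scale 4 (lCP M).
rewrite RintegralD//; [|exact: L1_scale|exact: L1_add].
rewrite RintegralD// !RintegralZl//.
have gk' : M%:R * \int[mu]_x `|g (x + z k) - g x| <= e / 4.
  apply: (@le_trans _ _ ((M%:R + 1) * (e / (4 * (M%:R + 1))))).
    apply: ler_pM => //; last by rewrite lerDl.
    exact: Rintegral_ge0.
  have M0 : M%:R + 1 != 0 :> R by rewrite gt_eqF// ltr_wpDl.
  by rewrite mulrC invfM -!mulrA mulVf// mulr1.
lra.
Qed.

End dominated_pairing.

(** Substitute y = x + z; evenness turns rho(- z) into rho(z). *)
Lemma Rintegral_mollify g (e : R) x : 0 < e -> L1 g ->
  \int[mu]_y (g y * mollifier e (x - y)) = \int[mu]_z (g (x + z) * mollifier e z).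
Proof.
move=> e0 lg.
rewrite -(@Rintegral_translate_L1 x (fun y => g y * mollifier e (x - y))).
  by apply: eq_Rintegral => z _; rewrite opprD addrCA subrr addr0 mollifierN addrC.
have [C hC] := @mollifier_bounded R n e.
apply: (L1_le _ (L1_scale C (L1_norm lg))).
  apply: measurable_funM; first exact: L1_measurable lg.
  apply: (@measurableT_comp _ _ _ _ _ _ (mollifier e)).
    by apply: continuous_measurable_rV; exact: continuous_mollifier.
  apply: measurable_fun_rVP => i; under eq_fun do rewrite !mxE.
  by apply: measurable_funB => //; exact: measurable_coord.
by move=> y; rewrite normrM mulrC ler_wpM2r.
Qed.

End mollification.

Section mollified_pairing.
Context {R : realType} {n : nat}.

Local Notation mu := (lebesgue_rV R n).
Local Notation L1 f := (mu.-integrable setT (EFin \o f)).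

Lemma measurable_addr2 :
  measurable_fun setT (fun p : 'rV[R]_n * 'rV[R]_n => p.1 + p.2).
Proof.
apply: measurable_fun_rVP => i; under eq_fun do rewrite mxE.
apply: measurable_funD.
- exact: (measurableT_comp (measurable_coord i) measurable_fst).
- exact: (measurableT_comp (measurable_coord i) measurable_snd).
Qed.

(** After the substitution the mollifier depends on z alone, and the pairings of F with translates
    of g are bounded uniformly in z by twice the integral of P. So the inner integrals over x have
    an integrable multiple of the mollifier as majorant. *)
Lemma mollified_pairing (F g P : 'rV[R]_n -> R) (e : R) : 0 < e ->
  measurable_fun setT F -> L1 g -> L1 P ->
  (forall x y, `|F x * g y| <= P x + P y) ->
  L1 (fun z => mollifier e z * \int[mu]_x (F x * g (x + z))) /\
  \int[mu]_x (F x * \int[mu]_y (g y * mollifier e (x - y))) =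
  \int[mu]_z (mollifier e z * \int[mu]_x (F x * g (x + z))).
Proof.
move=> e0 mF lg lP FgP.
have lrho := @L1_mollifier R n e e0; have [C hC] := @mollifier_bounded R n e.
pose K (x z : 'rV[R]_n) := F x * (g (x + z) * mollifier e z).
have mK : measurable_fun setT (fun p => K p.1 p.2).
  apply: measurable_funM; first exact: (measurableT_comp mF measurable_fst).
  apply: measurable_funM.
    exact: (measurableT_comp (L1_measurable lg) measurable_addr2).
  exact: (measurableT_comp (L1_measurable lrho) measurable_snd).
have lgrho x : L1 (fun z => g (x + z) * mollifier e z).
  have lgx : L1 (fun z => g (x + z)).
    by have := L1_translate x lg; under eq_fun do rewrite addrC.
  apply: (L1_le _ (L1_scale C (L1_norm lgx))).
    by apply: measurable_funM; [exact: L1_measurable lgx|exact: L1_measurable lrho].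
  by move=> z; rewrite normrM mulrC ler_wpM2r.
have lK1 x : L1 (K x) by exact: L1_scale.
have lK2 z : L1 (K^~ z).
  have := L1_scale (mollifier e z) (L1_pairing mF lg lP FgP z).
  by rewrite /K; under eq_fun do rewrite mulrC -mulrA.
have KE z : \int[mu]_x K x z = mollifier e z * \int[mu]_x (F x * g (x + z)).
  rewrite -RintegralZl//; last exact: (L1_pairing mF lg lP FgP z).
  by apply: eq_Rintegral => x _; rewrite /K mulrA mulrC.
have lb := L1_scale (2 * \int[mu]_x P x) lrho.
have Kb z : \int[mu]_x `|K x z| <= (2 * \int[mu]_x P x) * mollifier e z.
  rewrite (@eq_Rintegral _ _ _ _ _ (fun x => mollifier e z * `|F x * g (x + z)|)).
    rewrite RintegralZl//; last exact: L1_norm (L1_pairing mF lg lP FgP z).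
    by rewrite mulrC ler_wpM2r ?mollifier_ge0//; exact: le_Rintegral_pairing.
  by move=> x _; rewrite /K mulrA normrM mulrC (ger0_norm (mollifier_ge0 _ _)).
split.
  by have := L1_Rintegral mK lK2 lb Kb; under eq_fun do rewrite KE.
rewrite -(eq_Rintegral _ (fun z _ => KE z)) -(Rintegral_fubini mK lK1 lK2 lb Kb).
apply: eq_Rintegral => x _.
by rewrite Rintegral_mollify// -RintegralZl.
Qed.

(** If H 0 were nonzero, [H 0 * H] would be positive on a small cube; its product with the mollifier
    would then be nonnegative with integral 0, yet positive on that cube. The sum over i stays
    outside because only the sum is assumed to vanish. *)
Lemma mollified_pairing_eq0 m (F g : 'I_m -> 'rV[R]_n -> R) (P : 'rV[R]_n -> R) :
  (forall i, measurable_fun setT (F i)) -> (forall i, L1 (g i)) -> L1 P ->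
  (forall i x y, `|F i x * g i y| <= P x + P y) ->
  (forall e, 0 < e ->
    \sum_i \int[mu]_x (F i x * \int[mu]_y (g i y * mollifier e (x - y))) = 0) ->
  \sum_i \int[mu]_x (F i x * g i x) = 0.
Proof.
move=> mF lg lP FgP mol0.
pose H z := \sum_i \int[mu]_x (F i x * g i (x + z)).
have H0 : \sum_i \int[mu]_x (F i x * g i x) = H 0.
  by apply: eq_bigr => i _; apply: eq_Rintegral => x _; rewrite addr0.
rewrite H0; apply/eqP/negPn/negP => Hn0.
have cH (z : nat -> 'rV[R]_n) : z k @[k --> \oo] --> (0 : 'rV[R]_n) ->
    H (z k) @[k --> \oo] --> H 0.
  move=> z0; rewrite -H0; apply: cvg_big => [w|i _]; first exact: add_continuous.
  exact: cvg_pairing (mF i) (lg i) lP (FgP i) _ z0.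
have H2 : 0 < H 0 * H 0 by rewrite -expr2 exprn_even_gt0.
have [e e0 He] : exists2 e, 0 < e & forall z, cube e z -> 0 < H 0 * H z.
  (* Sequential continuity is enough: a bad point in each cube of radius 1 / (k + 1) would give a
     sequence tending to 0 along which the limit is violated. *)
  apply: contrapT => h.
  have hk (k : nat) : exists z, cube (k.+1%:R^-1) z /\ H 0 * H z <= 0.
    apply: contrapT => hk; apply: h; exists (k.+1%:R^-1); first by rewrite invr_gt0.
    move=> z cz; rewrite ltNge; apply/negP => Hz; apply: hk.
    by exists z.
  have [z hz] := choice hk.
  have z0 : z k @[k --> \oo] --> (0 : 'rV[R]_n).
    apply/cvgrPdist_lt => r r0.
    have := @cvg_harmonic R => /cvgrPdist_lt/(_ _ r0).
    apply: filterS => k; rewrite /harmonic/= sub0r normrN ger0_norm ?invr_ge0// => kr.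
    have [+ _] := hz k; rewrite /cube -ball_normE /= => zk.
    exact: lt_trans zk kr.
  have cHH : H 0 * H (z k) @[k --> \oo] --> H 0 * H 0.
    by apply: cvgM; [exact: cvg_cst|exact: cH].
  have : H 0 * H 0 <= 0.
    by apply: (cvgr_to_le cHH); apply: nearW => k; have [] := hz k.
  by rewrite leNgt H2.
have mp i := mollified_pairing e0 (mF i) (lg i) lP (FgP i).
pose phi z := \sum_i H 0 * (mollifier e z * \int[mu]_x (F i x * g i (x + z))).
have phiE z : phi z = mollifier e z * (H 0 * H z).
  by rewrite /phi -!mulr_sumr mulrCA.
have lphi : L1 phi by apply: L1_sum => i; apply: L1_scale; have [] := mp i.
have phi0 : \int[mu]_z phi z = 0.
  rewrite Rintegral_sum; last by move=> i; apply: L1_scale; have [] := mp i.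
  transitivity (H 0 * \sum_i \int[mu]_x (F i x * \int[mu]_y
      (g i y * mollifier e (x - y)))); last by rewrite mol0// mulr0.
  rewrite mulr_sumr; apply: eq_bigr => i _.
  by have [li ->] := mp i; rewrite RintegralZl.
have phi_ge0 z : 0 <= phi z.
  rewrite phiE; have [ze|ze] := pselect (cube e z).
    by rewrite mulr_ge0 ?mollifier_ge0// ltW// He.
  by rewrite mollifier_notin_cube// mul0r.
have : (\int[mu]_z `|(phi z)%:E| = 0)%E.
  under eq_integral do rewrite /= ger0_norm//.
  by rewrite -(fineK (integrable_fin_num measurableT lphi)) -[fine _]/(Rintegral _ _ _) phi0.
move/(ae_eq_integral_abs mu measurableT (measurable_int _ lphi)) => [N [mN N0 phiN]].
(* The cube, on which [phi] is positive, would lie in the null set N although its measure is (2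
   e)^n. *)
have : (mu (cube e) <= mu N)%E.
  apply: le_measure; rewrite ?inE//.
    by apply: open_measurable_rV; exact: open_cube.
  move=> z ze; apply: phiN => /= /(_ I) [phiz].
  have : 0 < phi z by rewrite phiE mulr_gt0 ?He ?mollifier_gt0.
  by rewrite phiz ltxx.
by rewrite N0 lebesgue_rV_cube// lee_fin leNgt exprn_gt0// pmulrn_lgt0.
Qed.

End mollified_pairing.

(** * Growth of a *)

Section growth.
Context {R : realType}.
Variables (a : R -> R) (a0 a1 : R).
Hypothesis a_cont : {within `[0, +oo[, continuous a}.
Hypothesis a_derivable : forall t : R, 0 < t -> derivable a t 1.
Hypothesis a_at0 : a 0 = 0.
Hypothesis a_pos : forall t : R, 0 < t -> 0 < a t.
Hypothesis a0_pos : 0 < a0.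
Hypothesis a1_pos : 0 < a1.
Hypothesis a_growth : forall t : R, 0 < t -> a0 <= t * derive1 a t / a t <= a1.

Lemma growth_ge0 t : 0 <= t -> 0 <= a t.
Proof. by rewrite le_eqVlt => /predU1P[<-|/a_pos/ltW//]; rewrite a_at0. Qed.

Lemma growth_derive_le t : 0 < t -> t * derive1 a t <= a1 * a t.
Proof. by move=> t0; have /andP[_] := a_growth t0; rewrite ler_pdivrMr ?a_pos. Qed.

Lemma growth_derive_ge0 t : 0 < t -> 0 <= derive1 a t.
Proof.
move=> t0; have /andP[+ _] := a_growth t0; rewrite ler_pdivlMr ?a_pos// => h.
rewrite -(pmulr_rge0 _ t0); apply: le_trans h.
by rewrite mulr_ge0 ?ltW// a_pos.
Qed.

(** Monotonicity is where the lower growth bound enters: with [a0] positive it makes the derivative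
    nonnegative. *)
Lemma growth_le s t : 0 <= s -> s <= t -> a s <= a t.
Proof.
apply: ger0_derive1_ndecry => // x; rewrite in_itv/= andbT => x0.
  exact: a_derivable.
exact: growth_derive_ge0.
Qed.

Lemma growth_cont t : 0 < t -> {for t, continuous a}.
Proof.
by move=> t0; apply: differentiable_continuous; apply/derivable1_diffP; exact: a_derivable.
Qed.

Lemma growth_measurable : measurable_fun (`[0, +oo[%classic : set R) a.
Proof. exact: subspace_continuous_measurable_fun. Qed.

Lemma growth_integrable t : lebesgue_measure.-integrable `[0, t] (EFin \o a).
Proof.
apply: continuous_compact_integrable; first exact: segment_compact.
apply: continuous_subspaceW a_cont.
exact: subset_itvl.
Qed.

Lemma is_derive_young_fun (t : R) : 0 < t -> is_derive t (1 : R) (young_fun a) (a t).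
Proof.
move=> t0.
(* The endpoint t + 1 makes t an interior point of the interval, as a two-sided derivative needs. *)
have [] := @continuous_FTC1_closed R a 0 t (t + 1) _ (growth_integrable _) t0 (growth_cont t0).
  by rewrite ltrDl.
by move=> dA AE; apply: DeriveDef => //; rewrite -derive1E.
Qed.

Lemma young_fun_ge0 t : 0 <= young_fun a t.
Proof.
apply: Rintegral_ge0 => s /=; rewrite in_itv/= => /andP[s0 _].
exact: growth_ge0.
Qed.

Lemma young_fun_measurable : measurable_fun (`[0, +oo[%classic : set R) (young_fun a).
Proof.
apply/measurable_fun_itv_obnd_cbndP.
apply: subspace_continuous_measurable_fun => //.
apply: derivable_within_continuous => t; rewrite in_itv/= andbT => t0.
by have [] := is_derive_young_fun t0.
Qed.

(** Compare derivatives: that of a(t) t is a(t) + t a'(t), at most (1 + a1) a(t). Hence [F] is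
    nondecreasing for positive arguments, and it remains to control it near 0. *)
Lemma mul_growth_le_young t : 0 <= t -> a t * t <= (1 + a1) * young_fun a t.
Proof.
rewrite le_eqVlt => /predU1P[<-|t0].
  by rewrite mulr0 mulr_ge0 ?young_fun_ge0// ltW// ltr_wpDl.
pose F s := (1 + a1) * young_fun a s - a s * s.
have dF (s : R) : 0 < s -> is_derive s (1 : R) F (a1 * a s - s * derive1 a s).
  move=> s0.
  have dA := is_derive_young_fun s0.
  have da : is_derive s (1 : R) a (derive1 a s).
    by rewrite derive1E; exact/derivableP/a_derivable.
  apply: is_derive_eq (is_deriveB (is_deriveZ (1 + a1) dA)
    (is_deriveM da (is_derive_id s (1 : R)))) _.
  rewrite /GRing.scale/=; lra.
have cF s : 0 < s -> {for s, continuous F}.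
  move=> s0; apply: differentiable_continuous; apply/derivable1_diffP.
  by have [] := dF _ s0.
have Fs s : 0 < s -> s < t -> F s <= F t.
  move=> s0 st; apply: (@ger0_derive1_ndecr R F s t) => //; last exact: ltW.
  - move=> x; rewrite in_itv/= => /andP[sx _].
    by have [] := dF x (lt_trans s0 sx).
  - move=> x; rewrite in_itv/= => /andP[sx _].
    have x0 := lt_trans s0 sx.
    rewrite derive1E; have [_ ->] := dF x x0.
    by rewrite subr_ge0 growth_derive_le.
  - apply: derivable_within_continuous => x; rewrite in_itv/= => /andP[sx _].
    by have [] := dF x (lt_le_trans s0 sx).
(* This lower bound, which tends to 0 with s, stands in for the value of [F] at 0. *)
have Ft s : 0 < s -> s < t -> - (a t * s) <= F t.
  move=> s0 st; apply: le_trans (Fs s s0 st).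
  rewrite /F -[leLHS]add0r lerD//.
    by rewrite mulr_ge0 ?young_fun_ge0// ltW// ltr_wpDl.
  by rewrite lerN2 ler_wpM2r ?(ltW s0)// growth_le// ltW.
rewrite -subr_ge0 -/(F t) leNgt; apply/negP => Ft0.
have at0 := a_pos t0.
(* The first term gives s < t, the second makes a(t) s at most - F(t) / 2, which contradicts
   [Ft]. *)
pose s := Num.min (t / 2) (- F t / (2 * a t)).
have s0 : 0 < s by rewrite lt_min !divr_gt0// ?oppr_gt0// mulr_gt0.
have st : s < t by rewrite gt_min ltr_pdivrMr// ltr_pMr// ltr1n.
have := Ft s s0 st; rewrite leNgt => /negP; apply.
rewrite ltrNr; apply: (@le_lt_trans _ _ (a t * (- F t / (2 * a t)))).
  by rewrite ler_pM2l// ge_min lexx orbT.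
rewrite invfM mulrC -!mulrA mulVf ?gt_eqF// mulr1.
by lra.
Qed.

(** Split at t = 1. Applied to t = |G(x)|, this bounds [Theta(G)] by a constant plus an integrable
    function. *)
Lemma growth_le_affine t : 0 <= t -> a t <= a 1 + a t * t.
Proof.
move=> t0; have [t1|t1] := leP t 1.
  apply: le_trans (growth_le t0 t1) _.
  by rewrite lerDl mulr_ge0// growth_ge0.
apply: (@le_trans _ _ (a t * t)).
  by rewrite ler_pMr ?(ltW t1)// a_pos// (lt_trans ltr01).
by rewrite lerDr growth_ge0.
Qed.

End growth.

(** * The Euclidean norm and the field [Theta] *)

Section enorm.
Context {R : realType} {n : nat}.
Implicit Types X Y : 'rV[R]_n.

Lemma dotp_ge0 X : 0 <= dotp X X.
Proof. by apply: sumr_ge0 => i _; rewrite -expr2 sqr_ge0. Qed.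

Lemma enorm_ge0 X : 0 <= enorm X.
Proof. exact: sqrtr_ge0. Qed.

Lemma enorm_sqr X : enorm X * enorm X = dotp X X.
Proof. by rewrite -expr2 sqr_sqrtr// dotp_ge0. Qed.

Lemma coord_le_enorm X i : `|X 0 i| <= enorm X.
Proof.
rewrite -sqrtr_sqr ler_sqrt ?dotp_ge0//.
by rewrite /dotp (bigD1 i)//= expr2 lerDl sumr_ge0// => j _; rewrite -expr2 sqr_ge0.
Qed.

Lemma dotp_Theta (a : R -> R) X : dotp (Theta a X) X = a (enorm X) * enorm X.
Proof.
have -> : dotp (Theta a X) X = (a (enorm X) / enorm X) * dotp X X.
  by rewrite /dotp mulr_sumr; apply: eq_bigr => i _; rewrite mxE mulrA.
rewrite -enorm_sqr; have [->|X0] := eqVneq (enorm X) 0; first by rewrite !mulr0.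
by rewrite mulrA mulfVK.
Qed.

Lemma Theta_coord_le (a : R -> R) X i : 0 <= a (enorm X) ->
  `|Theta a X 0 i| <= a (enorm X).
Proof.
move=> aX; rewrite mxE normrM ger0_norm ?divr_ge0 ?enorm_ge0//.
have [X0|X0] := eqVneq (enorm X) 0; first by move: aX; rewrite X0 invr0 mulr0 mul0r.
rewrite -mulrA ler_piMr// ler_pdivrMl ?mulr1 ?coord_le_enorm//.
by rewrite lt_neqAle eq_sym X0 enorm_ge0.
Qed.

End enorm.

(** * Mollified weak gradients *)

Section weak_gradient_mollification.
Context {R : realType} {n : nat}.

Local Notation mu := (lebesgue_rV R n).
Local Notation L1 f := (mu.-integrable setT (EFin \o f)).

Lemma measurable_subr2 :
  measurable_fun setT (fun p : 'rV[R]_n * 'rV[R]_n => p.1 - p.2).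
Proof.
apply: measurable_fun_rVP => i; under eq_fun do rewrite !mxE.
apply: measurable_funB.
- exact: (measurableT_comp (measurable_coord i) measurable_fst).
- exact: (measurableT_comp (measurable_coord i) measurable_snd).
Qed.

Lemma measurable_subl (x : 'rV[R]_n) :
  measurable_fun setT (fun y : 'rV[R]_n => x - y).
Proof.
apply: measurable_fun_rVP => i; under eq_fun do rewrite !mxE.
by apply: measurable_funB => //; exact: measurable_coord.
Qed.

Lemma L1_mul_bounded (u D : 'rV[R]_n -> R) C : L1 u -> measurable_fun setT D ->
  (forall x, `|D x| <= C) -> L1 (fun x => u x * D x).
Proof.
move=> lu mD DC; apply: (L1_le _ (L1_scale C (L1_norm lu))).
  by apply: measurable_funM => //; exact: L1_measurable lu.
by move=> x; rewrite normrM mulrC ler_wpM2r.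
Qed.

Section smear.
Variables (F T u D : 'rV[R]_n -> R) (c C : R).
Hypotheses (mF : measurable_fun setT F) (FT : forall x, `|F x| <= c + T x).
Hypothesis T0 : forall x, 0 <= T x.
Hypotheses (lT : L1 T) (lu : L1 u) (lD : L1 D) (DC : forall x, `|D x| <= C).

Let lDy y : L1 (fun x => D (x - y)).
Proof. have := L1_translate (- y) lD. by []. Qed.

Let bound y x : `|F x * D (x - y)| <= c * `|D (x - y)| + C * T x.
Proof.
rewrite normrM; apply: (@le_trans _ _ ((c + T x) * `|D (x - y)|)).
  exact: ler_wpM2r.
by rewrite mulrDl lerD2l mulrC ler_wpM2r.
Qed.

Let lbound y : L1 (fun x => c * `|D (x - y)| + C * T x).
Proof. by apply: L1_add; apply: L1_scale => //; exact: (L1_norm (lDy y)). Qed.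

Lemma L1_smear y : L1 (fun x => F x * D (x - y)).
Proof.
apply: (L1_le _ (lbound y)); last exact: bound.
by apply: measurable_funM => //; exact: L1_measurable (lDy y).
Qed.

(** The integral of |F(x) D(x - y)| over x is at most c times that of |D| plus C times that of T,
    uniformly in y, so integrability of u suffices for Fubini. The exchange moves the kernel from u
    onto F, where the equation can be used. *)
Lemma smear_swap : L1 (fun y => u y * \int[mu]_x (F x * D (x - y))) /\
  \int[mu]_x (F x * \int[mu]_y (u y * D (x - y))) =
  \int[mu]_y (u y * \int[mu]_x (F x * D (x - y))).
Proof.
pose K (x y : 'rV[R]_n) := F x * (u y * D (x - y)).
have mK : measurable_fun setT (fun p => K p.1 p.2).
  apply: measurable_funM; first exact: (measurableT_comp mF measurable_fst).
  apply: measurable_funM.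
    exact: (measurableT_comp (L1_measurable lu) measurable_snd).
  exact: (measurableT_comp (L1_measurable lD) measurable_subr2).
have luD x : L1 (fun y => u y * D (x - y)).
  apply: (L1_mul_bounded lu) => //.
  exact: (measurableT_comp (L1_measurable lD) (measurable_subl x)).
have lK1 x : L1 (K x) by exact: L1_scale.
have KE x y : K x y = u y * (F x * D (x - y)) by rewrite /K mulrCA.
have lK2 y : L1 (K^~ y).
  by have := L1_scale (u y) (L1_smear y); under eq_fun do rewrite -KE.
pose B := c * (\int[mu]_x `|D x|) + C * (\int[mu]_x T x).
have lb : L1 (fun y => B * `|u y|) by exact: L1_scale (L1_norm lu).
have Kb y : \int[mu]_x `|K x y| <= B * `|u y|.
  rewrite (@eq_Rintegral _ _ _ _ _ (fun x => `|u y| * `|F x * D (x - y)|)); last first.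
    by move=> x _; rewrite KE normrM.
  rewrite RintegralZl//; last exact: L1_norm (L1_smear y).
  rewrite mulrC ler_wpM2r// /B.
  rewrite -(@Rintegral_translate_L1 _ _ (- y) (fun x => `|D x|)); last exact: L1_norm.
  rewrite -RintegralZl//; last exact: (L1_norm (lDy y)).
  rewrite -[X in _ <= _ + X]RintegralZl// -RintegralD//; last 2 first.
  - by apply: L1_scale; exact: (L1_norm (lDy y)).
  - exact: L1_scale.
  apply: le_Rintegral => //; first exact: L1_norm (L1_smear y).
have IKE y : \int[mu]_x K x y = u y * \int[mu]_x (F x * D (x - y)).
  rewrite -RintegralZl//; last exact: L1_smear.
  by apply: eq_Rintegral => x _; rewrite KE.
split; first by have := L1_Rintegral mK lK2 lb Kb; under eq_fun do rewrite IKE.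
transitivity (\int[mu]_x \int[mu]_y K x y).
  by apply: eq_Rintegral => x _; rewrite RintegralZl.
by rewrite (Rintegral_fubini mK lK1 lK2 lb Kb); apply: eq_Rintegral => y _.
Qed.

End smear.

(** Test the weak gradient with y -> rho(x - y): the sign from the inner derivative cancels the one
    of the integration by parts. *)
Lemma weak_gradient_mollifier (u : 'rV[R]_n -> R) (G : 'rV[R]_n -> 'rV[R]_n) e i x :
  (0 < n)%N -> 0 < e -> L1 u -> is_weak_gradient u G ->
  \int[mu]_y (G y 0 i * mollifier e (x - y)) =
  \int[mu]_y (u y * dmollifier e i (x - y)).
Proof.
move=> n0 e0 lu [_ _ uG].
have N1 : `|-1| = 1 :> R by rewrite normrN1.
have [C hC] := @dmollifier_bounded R n e i.
have luD : L1 (fun y => u y * dmollifier e i (x - y)).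
  apply: (L1_mul_bounded lu) => //.
  exact: (measurableT_comp (L1_measurable (@L1_dmollifier R n e i e0)) (measurable_subl x)).
have := uG _ (test_function_mollifier x n0 e0 N1) i.
rewrite partial_mollifier => /(congr1 fine).
under eq_integral do rewrite scaleN1r mulrCA.
under [in X in _ = X -> _]eq_integral do rewrite scaleN1r.
rewrite fineN -[LHS]/(Rintegral _ _ _) RintegralZl// mulN1r => /oppr_inj.
by rewrite /Rintegral => ->.
Qed.

Lemma is_derive_line (f : 'rV[R]_n -> R) (x v : 'rV[R]_n) (t d : R) :
  is_derive (x + t *: v) v f d -> is_derive t (1 : R) (fun t => f (x + t *: v)) d.
Proof.
move=> [df fd].
have E : (fun h => h^-1 *: (((fun t => f (x + t *: v)) \o shift t) (h *: (1 : R)) - f (x + t *: v)))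
   = (fun h => h^-1 *: ((f \o shift (x + t *: v)) (h *: v) - f (x + t *: v))).
  apply/funext => h; congr (_ *: (f _ - _)) => /=.
  by rewrite [_ *: 1]mulr1 scalerDl addrCA.
apply: DeriveDef; first by rewrite /derivable E.
by rewrite /derive E.
Qed.

(** Move the centre along the i-th axis: the mollification [W] has derivative 0, hence is constant,
    while dominated convergence sends it to 0 because the kernel leaves every fixed y. *)
Lemma mollification_eq0 (u : 'rV[R]_n -> R) (i : 'I_n) e : 0 < e -> L1 u ->
  (forall x : 'rV[R]_n, \int[mu]_y (u y * dmollifier e i (x - y)) = 0) ->
  forall x : 'rV[R]_n, \int[mu]_y (u y * mollifier e (x - y)) = 0.
Proof.
move=> e0 lu du0 x.
have [C hC] := @mollifier_bounded R n e.
have [C' hC'] := @dmollifier_bounded R n e i.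
have mm (z : 'rV[R]_n) : measurable_fun setT (fun y : 'rV[R]_n => mollifier e (z - y)).
  exact: (measurableT_comp (L1_measurable (@L1_mollifier R n e e0)) (measurable_subl z)).
pose v : 'rV[R]_n := delta_mx 0 i.
pose f (t : R) (y : 'rV[R]_n) := u y * mollifier e (x + t *: v - y).
pose W (t : R) := \int[mu]_y f t y.
have lf t : L1 (f t) by exact: L1_mul_bounded lu (mm _) (fun y => hC _).
have df (y : 'rV[R]_n) (t : R) : is_derive t (1 : R) (f ^~ y) (u y * dmollifier e i (x + t *: v - y)).
  have h : is_derive t (1 : R) (fun t => mollifier e (x - y + t *: v))
      (dmollifier e i (x + t *: v - y)).
    apply: is_derive_line; rewrite addrAC.
    by apply: is_derive_prodf => s; exact: derivable_bump.
  rewrite (_ : f^~ y = u y \*: (fun t => mollifier e (x - y + t *: v))).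
    exact: (is_deriveZ (u y) h).
  by apply/funext => s; rewrite /f addrAC.
have dW (t : R) : is_derive t (1 : R) W 0.
  (* Any open interval around t serves: the majorant [C' * |u|] of the derivative is uniform in
     t. *)
  have It : `]t - 1, t + 1[%classic t by rewrite /= in_itv/= ltrBlDr ltrDl ltr01.
  have dfE (s : R) (y : 'rV[R]_n) : partial1of2 f s y = u y * dmollifier e i (x + s *: v - y).
    by rewrite partial1of2E; have [_] := df y s.
  have lG := L1_scale C' (L1_norm lu).
  have lei (s : R) (y : 'rV[R]_n) : `|partial1of2 f s y| <= C' * `|u y|.
    by rewrite dfE normrM mulrC ler_wpM2r.
  have dfd (s : R) (y : 'rV[R]_n) : derivable (f^~ y) s 1 by have [] := df y s.
  have G0 y : 0 <= C' * `|u y| by exact: le_trans (lei t y).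
  apply: DeriveDef.
    exact: (derivable_under_integral measurableT It
      (fun s _ => lf s) (fun s y _ _ => dfd s y) G0 lG (fun s y _ _ => lei s y)).
  rewrite -derive1E (differentiation_under_integral measurableT It
      (fun s _ => lf s) (fun s y _ _ => dfd s y) G0 lG (fun s y _ _ => lei s y)).
  under eq_Rintegral do rewrite dfE.
  exact: du0.
have W0 (k : nat) : W k%:R = W 0 by exact: is_derive_0_is_cst.
have cW : W k%:R @[k --> \oo] --> (0 : R).
  rewrite -[X in _ --> X](_ : \int[mu]_y (0 : R) = 0); last first.
    by rewrite /Rintegral integral0.
  apply: (Rdominated_cvg (g := fun y => C * `|u y|)) => //.
  - by move=> k; exact: L1_measurable (lf _).
  - exact: L1_scale (L1_norm lu).
  - move=> y; apply: cvg_near_cst.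
    (* From this k on, the i-th coordinate of x + k v - y exceeds e, so the mollifier vanishes
       there. *)
    exists (Num.truncn (e + `|x 0 i - y 0 i|)).+1 => // k /= ek.
    rewrite /f (@mollifier_eq0 _ _ _ _ i) ?mulr0//.
    rewrite !mxE !eqxx mulr1.
    have h : e + `|x 0 i - y 0 i| < k%:R.
      by apply: lt_le_trans (truncnS_gt _) _; rewrite ler_nat.
    have h2 := ler_norm (- (x 0 i - y 0 i)); rewrite normrN in h2.
    apply: le_trans (ler_norm _); lra.
  - by move=> k y; rewrite normrM mulrC ler_wpM2r.
have -> : \int[mu]_y (u y * mollifier e (x - y)) = W 0.
  by apply: eq_Rintegral => y _; rewrite /f scale0r addr0.
move: cW; under eq_fun do rewrite W0; move=> cW.
apply: (cvg_unique _ _ cW) => //; exact: cvg_cst.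
Qed.

End weak_gradient_mollification.

(** * From vanishing integrals to vanishing almost everywhere *)

Section vanishing.
Context {R : realType} {n : nat}.

Local Notation mu := (lebesgue_rV R n).
Local Notation L1 f := (mu.-integrable setT (EFin \o f)).

Lemma Rintegral_ge0_eq0_ae (f : 'rV[R]_n -> R) : L1 f -> (forall x, 0 <= f x) ->
  \int[mu]_x f x = 0 -> {ae mu, forall x, f x = 0}.
Proof.
move=> lf f0 If0.
have : (\int[mu]_x `|(f x)%:E| = 0)%E.
  under eq_integral do rewrite /= ger0_norm//.
  by rewrite -(fineK (integrable_fin_num measurableT lf)) -[fine _]/(Rintegral _ _ _) If0.
move/(ae_eq_integral_abs mu measurableT (measurable_int _ lf)).
by apply: filterS => x /(_ I) [].
Qed.

Lemma mollifications_eq0_ae (u : 'rV[R]_n -> R) : L1 u ->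
  (forall e, 0 < e -> forall x, \int[mu]_y (u y * mollifier e (x - y)) = 0) ->
  {ae mu, forall x, u x = 0}.
Proof.
move=> lu mol0.
(* A sign without the value 0: |s| = 1 everywhere, and s u = |u| also where u vanishes. *)
pose s (x : 'rV[R]_n) : R := if 0 < u x then 1 else -1.
have mu_ := L1_measurable lu.
have ms : measurable_fun setT s.
  by apply: measurable_fun_ifT => //; exact: measurable_fun_ltr.
have su x y : `|s x * u y| <= `|u x| + `|u y|.
  rewrite normrM (_ : `|s x| = 1) ?mul1r ?lerDr//.
  by rewrite /s; case: ifP => _; rewrite ?normrN normr1.
have := @mollified_pairing_eq0 R n 1 (fun=> s) (fun=> u) (fun x => `|u x|)
  (fun=> ms) (fun=> lu) (L1_norm lu) (fun=> su).
rewrite big_ord1 => h.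
have {}h : \int[mu]_x `|u x| = 0.
  rewrite -[RHS]h.
    apply: eq_Rintegral => x _; rewrite /s; case: ltP => u0.
      by rewrite mul1r gtr0_norm.
    by rewrite mulN1r ler0_norm.
  move=> e e0; rewrite big_ord1.
  under eq_Rintegral do rewrite mol0// mulr0.
  by rewrite /Rintegral integral0.
have := Rintegral_ge0_eq0_ae (L1_norm lu) (fun=> normr_ge0 _) h.
by apply: filterS => x /eqP; rewrite normr_eq0 => /eqP.
Qed.

End vanishing.

Unset Implicit Arguments.

Theorem corollary1p1 (R : realType) (n : nat) (hn : (2 <= n)%N)
  (a : R -> R) (a0 a1 : R)
  (a_cont : {within `[0, +oo[, continuous a})
  (a_derivable : forall t : R, 0 < t -> derivable a t 1)
  (a_deriv_cont : forall t : R, 0 < t -> {for t, continuous (derive1 a)})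
  (a_at0 : a 0 = 0)
  (a_pos : forall t : R, 0 < t -> 0 < a t)
  (a0_pos : 0 < a0) (a1_pos : 0 < a1)
  (a_growth : forall t : R, 0 < t -> a0 <= t * derive1 a t / a t <= a1)
  (u : 'rV[R]_n -> R)
  (u_sobolev : u \in orlicz_sobolev (young_fun a))
  (u_harmonic : A_harmonic a u) :
  {ae lebesgue_rV R n, forall x, u x = 0}.
Proof.
have n0 : (0 < n)%N by exact: ltn_trans hn.
move: u_sobolev; rewrite inE => -[[lu _] [G0 uG0] [lG AG]].
(* The existence clause of the Sobolev space guarantees that the chosen [weak_grad u] is a weak
   gradient and not the default value. *)
have uG : is_weak_gradient u (weak_grad u) by exact: (xgetPex (cst 0) (ex_intro _ G0 uG0)).
set G := weak_grad u in uG lG AG u_harmonic.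
set mu := lebesgue_rV R n.
have a_ge0 := growth_ge0 a_at0 a_pos.
have a_le := growth_le a_cont a_derivable a_pos a0_pos a_growth.
have E0 (x : 'rV[R]_n) : 0 <= enorm (G x) by exact: enorm_ge0.
have mG i : measurable_fun setT (fun x => G x 0 i) by have [_ /(_ i)[]] := uG.
have mE : measurable_fun setT (fun x => enorm (G x)) by exact: L1_measurable lG.
(* [a] is controlled only on the closed half-line, which contains all values of [enorm]. *)
have m_comp (f : R -> R) : measurable_fun (`[0, +oo[%classic : set R) f ->
    measurable_fun setT (fun x => f (enorm (G x))).
  move=> mf; apply: (measurable_comp _ _ mf mE) => //.
  by move=> _ [x _ <-]; rewrite /= in_itv/= E0.
have ma := growth_measurable a_cont.
pose T (x : 'rV[R]_n) := a (enorm (G x)) * enorm (G x).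
have T0 x : 0 <= T x by rewrite mulr_ge0// a_ge0.
have lT : mu.-integrable setT (EFin \o T).
  have mA := m_comp _ (young_fun_measurable a_cont a_derivable).
  have lA : mu.-integrable setT (EFin \o (fun x => young_fun a (enorm (G x)))).
    apply/integrableP; split; first exact/measurable_EFinP.
    apply: le_lt_trans AG; rewrite le_eqVlt; apply/orP; left; apply/eqP.
    apply: eq_integral => x _; rewrite /= !ger0_norm//.
    exact: (young_fun_ge0 a_at0 a_pos).
  apply: (L1_le _ (L1_scale (1 + a1) lA)).
    by apply: measurable_funM => //; exact: m_comp.
  move=> x; rewrite ger0_norm//.
  exact: (mul_growth_le_young a_cont a_derivable a_at0 a_pos a0_pos a1_pos a_growth).
pose F (i : 'I_n) (x : 'rV[R]_n) := Theta a (G x) 0 i.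
have mF i : measurable_fun setT (F i).
  rewrite (_ : F i = fun x => a (enorm (G x)) / enorm (G x) * G x 0 i); last first.
    by apply/funext => x; rewrite /F mxE.
  apply: measurable_funM => //; apply: (m_comp (fun t => a t / t)).
  (* The quotient a(t) / t may be discontinuous at 0; removing this one point does not affect
     measurability. *)
  apply/measurable_fun_itv_obnd_cbndP.
  apply: subspace_continuous_measurable_fun => //.
  apply: continuous_in_subspaceT => t; rewrite inE /= in_itv/= andbT => t0.
  apply: cvgM; first exact: growth_cont.
  by apply: cvgV => //; rewrite gt_eqF.
have Fa i x : `|F i x| <= a (enorm (G x)) by apply: Theta_coord_le; exact: a_ge0.
have lGi i : mu.-integrable setT (EFin \o (fun x => G x 0 i)).
  by apply: L1_le (mG i) lG _ => x; exact: coord_le_enorm.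
(* The larger of the two norms, put in both factors, gives T at the corresponding point. *)
have FG i x y : `|F i x * G y 0 i| <= T x + T y.
  rewrite normrM; apply: (@le_trans _ _ (a (enorm (G x)) * enorm (G y))).
    by apply: ler_pM => //; exact: coord_le_enorm.
  have [xy|yx] := leP (enorm (G y)) (enorm (G x)).
    by apply: (@le_trans _ _ (T x)); rewrite ?lerDl// ler_wpM2l// a_ge0.
  apply: (@le_trans _ _ (T y)); rewrite ?lerDr// ler_wpM2r//.
  by apply: a_le => //; exact: ltW.
have FT i x : `|F i x| <= a 1 + T x.
  apply: le_trans (Fa i x) _.
  exact: (growth_le_affine a_cont a_derivable a_at0 a_pos a0_pos a_growth).
have GD e x i : 0 < e -> \int[mu]_y (G y 0 i * mollifier e (x - y)) =
    \int[mu]_y (u y * dmollifier e i (x - y)).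
  by move=> e0; exact: weak_gradient_mollifier.
have FD e y : 0 < e -> \sum_i \int[mu]_x (F i x * dmollifier e i (x - y)) = 0.
  move=> e0.
  have lFD i : mu.-integrable setT (EFin \o (fun x => F i x * dmollifier e i (x - y))).
    have [C hC] := @dmollifier_bounded R n e i.
    exact: (L1_smear (mF i) (FT i) T0 lT (@L1_dmollifier R n e i e0) hC).
  have N1 : `|1| = 1 :> R by rewrite normr1.
  have hh := u_harmonic _ (test_function_mollifier (- y) n0 e0 N1).
  rewrite -Rintegral_sum// -[RHS]/(fine 0%E) -hh.
  rewrite /Rintegral; congr fine; apply: eq_integral => x _; congr EFin.
  apply: eq_bigr => i _; rewrite /grad mxE partial_mollifier mul1r scale1r.
  by rewrite addrC.
have pair0 : \sum_i \int[mu]_x (F i x * G x 0 i) = 0.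
  apply: (mollified_pairing_eq0 mF lGi lT FG) => e e0.
  (* Mollifying G_i means pairing u with the differentiated kernel; Fubini then hands that kernel to
     F_i, and the sum over i is the tested equation [FD]. *)
  have swap i : mu.-integrable setT (EFin \o
        (fun y => u y * \int[mu]_x (F i x * dmollifier e i (x - y)))) /\
      \int[mu]_x (F i x * \int[mu]_y (G y 0 i * mollifier e (x - y))) =
      \int[mu]_y (u y * \int[mu]_x (F i x * dmollifier e i (x - y))).
    have [C hC] := @dmollifier_bounded R n e i.
    have [luF <-] := smear_swap (mF i) (FT i) T0 lT lu (@L1_dmollifier R n e i e0) hC.
    by split=> //; apply: eq_Rintegral => x _; rewrite GD.
  under eq_bigr do rewrite (swap _).2.
  rewrite -Rintegral_sum; last by move=> i; exact: (swap i).1.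
  under eq_Rintegral do rewrite -mulr_sumr FD// mulr0.
  by rewrite /Rintegral integral0.
have T_ae : {ae mu, forall x, T x = 0}.
  apply: Rintegral_ge0_eq0_ae => //; rewrite -pair0 -Rintegral_sum; last first.
    move=> i; have := L1_pairing (mF i) (lGi i) lT (FG i) 0.
    by under eq_fun do rewrite addr0.
  by apply: eq_Rintegral => x _; rewrite /T -dotp_Theta.
have G_ae i : {ae mu, forall x, G x 0 i = 0}.
  apply: filterS T_ae => x Tx.
  have [Ex|Ex] := eqVneq (enorm (G x)) 0.
    by apply/eqP; rewrite -normr_le0 -Ex coord_le_enorm.
  have E_gt0 : 0 < enorm (G x) by rewrite lt_neqAle eq_sym Ex E0.
  by have := mulr_gt0 (a_pos _ E_gt0) E_gt0; rewrite -/(T x) Tx ltxx.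
apply: mollifications_eq0_ae => // e e0.
(* Any coordinate direction serves. *)
have i : 'I_n := Ordinal n0.
apply: (mollification_eq0 (i := i)) => // x.
rewrite -GD// /Rintegral (@ae_eq_integral _ _ _ mu setT (cst 0%E)) ?integral0//.
  apply/measurable_EFinP; apply: measurable_funM => //.
  exact: (measurableT_comp (L1_measurable (@L1_mollifier R n e e0)) (measurable_subl x)).
by apply: filterS (G_ae i) => y Gy _; rewrite Gy mul0r.
Qed.
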